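(* Let $P$ be a zonotope which is a simple polytope and let $\mathbf{c}$ be a generic cost vector. Then the poset whose Hasse diagram is $G(P,\mathbf{c})$ has every open interval with order complex homotopy equivalent to a ball or a sphere.
   Context: A zonotope is a Minkowski sum of finitely many line segments. A polytope is simple if for each vertex $v$ and each set of $i$ edges at $v$ there is an $i$-dimensional face containing $v$ and those edges. $\mathbf{c}$ is generic if it takes distinct values on distinct vertices of $P$. $G(P,\mathbf{c})$ is the 1-skeleton of $P$ with each edge oriented from the endpoint with smaller $\mathbf{c}$-value to the one with larger $\mathbf{c}$-value; for such $P$ it is the Hasse diagram of a poset (the one with $u\le v$ iff there is a directed path from $u$ to $v$). The order complex of a poset is the simplicial complex of its chains. *)

(* Defs.v *)
From HB Require Import structures.
From mathcomp Require Import all_boot all_order all_algebra finmap.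
From mathcomp Require Import all_classical all_reals all_analysis.

Set Implicit Arguments.
Unset Strict Implicit.
Unset Printing Implicit Defensive.

Import Order.TTheory GRing.Theory Num.Theory.
Import numFieldNormedType.Exports.

Local Open Scope classical_set_scope.
Local Open Scope ring_scope.

Section Polytopes.
Context {R : realType} {d : nat}.
Local Notation V := 'rV[R]_d.
Implicit Types (P F e : set V) (u v w x y c : V).

Definition dot x y : R := \sum_(i < d) x 0 i * y 0 i.

Definition segment x y : set V :=
  [set z | exists2 t : R, 0 <= t <= 1 & z = (1 - t) *: x + t *: y].

Definition minkowski_sum n (A : 'I_n -> set V) : set V :=
  [set x | exists2 f : 'I_n -> V, forall i, A i (f i) & x = \sum_(i < n) f i].

Definition is_zonotope P : Prop :=
  exists n (a b : 'I_n -> V), P = minkowski_sum (fun i => segment (a i) (b i)).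

(* Intersection of P with {w . x = t}, where w . x <= t is valid on P; w = 0
   is allowed, so P itself (t = 0) and the empty set (t = 1) are faces. *)
Definition is_face P F : Prop :=
  exists w (t : R),
    (forall x, P x -> dot w x <= t) /\ F = [set x | P x /\ dot w x = t].

(* F is nonempty and its affine hull has direction space U of dimension k. *)
Definition affine_dim F (k : nat) : Prop :=
  F !=set0 /\
  exists U : {vspace V},
    [/\ \dim U = k,
        forall x y, F x -> F y -> x - y \in U &
        forall W : {vspace V},
          (forall x y, F x -> F y -> x - y \in W) -> (U <= W)%VS].

Definition is_kface P (k : nat) F : Prop := is_face P F /\ affine_dim F k.

Definition is_vertex P v : Prop := is_kface P 0 [set v].

Definition is_edge P e : Prop := is_kface P 1 e.

Definition is_simple P : Prop :=
  forall v, is_vertex P v ->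
  forall (i : nat) (E : set (set V)),
    (E #= `I_i)%card ->
    (forall e, E e -> is_edge P e /\ e v) ->
    exists F, [/\ is_kface P i F, F v & forall e, E e -> e `<=` F].

Definition generic P c : Prop :=
  forall u v, is_vertex P u -> is_vertex P v -> dot c u = dot c v -> u = v.

(* The arcs of G(P, c). *)
Definition G_arc P c u v : Prop :=
  [/\ is_vertex P u, is_vertex P v,
      exists2 e, is_edge P e & e u /\ e v &
      dot c u < dot c v].

(* There is a (possibly trivial) directed path from u to v in G(P, c). *)
Definition G_le P c u v : Prop :=
  is_vertex P u /\
  exists2 s : seq V, path (fun x y => `[< G_arc P c x y >]) u s & last u s = v.

End Polytopes.

Definition open_interval {T : Type} (le : T -> T -> Prop) (u v : T) : set T :=
  [set w | [/\ le u w, w <> u, le w v & w <> v]].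

(* The abstract simplicial complex of finite chains of A ordered by le; the
   empty chain is included. *)
Definition order_complex {T : choiceType} (le : T -> T -> Prop) (A : set T) :
    set {fset T} :=
  [set s : {fset T} | (forall x, x \in s -> A x) /\
     (forall x y, x \in s -> y \in s -> le x y \/ le y x)].

(* Barycentric coordinates supported on a face of K, with the product topology
   of T -> R. When K has finitely many vertices (the only use here) this is
   the usual topology of the geometric realization. *)
Definition realization (R : realType) {T : choiceType} (K : set {fset T}) :
    set {ptws T -> R} :=
  [set a : {ptws T -> R} | exists2 s : {fset T}, K s &
     [/\ forall x, 0 <= a x,
         forall x, x \notin s -> a x = 0 &
         \sum_(x <- s) a x = 1]].

Arguments realization R {T} K.

Section Homotopy.
Variable R : realType.

(* f and g, as maps A -> B, are homotopic. A map between subspaces A and B is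
   represented by a total function that is continuous on A and sends A to B. *)
Definition homotopic_maps {X Y : topologicalType} (A : set X) (B : set Y)
    (f g : X -> Y) : Prop :=
  exists H : R * X -> Y,
    [/\ {within `[0, 1] `*` A, continuous H},
        forall t x, 0 <= t <= 1 -> A x -> B (H (t, x)),
        forall x, A x -> H (0, x) = f x &
        forall x, A x -> H (1, x) = g x].

Definition homotopy_equivalent {X Y : topologicalType}
    (A : set X) (B : set Y) : Prop :=
  exists (f : X -> Y) (g : Y -> X),
    [/\ {within A, continuous f} /\ (forall x, A x -> B (f x)),
        {within B, continuous g} /\ (forall y, B y -> A (g y)),
        homotopic_maps A A (g \o f) id &
        homotopic_maps B B (f \o g) id].

Definition unit_ball (n : nat) : set 'rV[R]_n := [set x | dot x x <= 1].

(* The sphere of dimension n - 1; it is empty for n = 0. *)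
Definition unit_sphere (n : nat) : set 'rV[R]_n := [set x | dot x x = 1].

Definition homotopy_ball_or_sphere {X : topologicalType} (A : set X) : Prop :=
  exists n : nat, homotopy_equivalent A (@unit_ball n) \/
                  homotopy_equivalent A (@unit_sphere n).

End Homotopy.

Arguments homotopy_ball_or_sphere R {X} A.

(* Main.v *)
Require Import Defs.
From mathcomp Require Import all_boot all_order all_algebra finmap.
From mathcomp Require Import all_classical all_reals all_analysis.
From mathcomp Require Import ring lra.
Import numFieldNormedType.Exports.

Set Implicit Arguments.
Unset Strict Implicit.
Unset Printing Implicit Defensive.

Import Order.TTheory GRing.Theory Num.Theory.

Local Open Scope classical_set_scope.
Local Open Scope ring_scope.

(* Write P as a zonotope with generators z_i, all oriented so that c.z_i > 0. A
   vertex v is encoded by the set Inv(v) of generators it uses, and the poset is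
   inclusion of these sets: at a vertex u the directions of the edges generate
   the cone of P - u, so an edge can always be chosen to stay below a given v.
   Since P is simple, the edge directions at u are linearly independent, and any
   set S of upward edges at u spans a face of P with top J(S), which is the least
   vertex above u and the other endpoints of the edges in S.

   Let C be the set of upward edges at u whose endpoint is below v and, for x in
   (u, v), let A(x) be the set of those whose endpoint is below x. Then A and J
   are monotone, J(A(x)) <= x and A(J(S)) = S, so (u, v) is homotopy equivalent
   to the poset of nonempty subsets S of C with J(S) <> v, i.e. to a simplex if
   J(C) <> v and to the boundary of a simplex if J(C) = v. *)

(** * Gordan's theorem and pointed cones *)

(** The map sending [x] to [J (A x)] is monotone and lies below the identity, but sliding the mass
    of a chain [x < y] linearly onto its image can leave the complex: [x] and [J (A y)] may be
    incomparable. The mass is therefore moved from the bottom of the chain upwards, so that moved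
    points always precede unmoved ones. To obtain explicit continuous maps, chains are compared with
    nonnegative vectors indexed by the edges in [C]: a chain yields the mass found above each edge,
    and a vector yields the chain of its superlevel sets, in place of a barycentric subdivision.
    Vectors matter only up to a positive factor, so ball and sphere are reached by elementary
    formulas. On the geometric side, independence of the edge directions gives a functional that is
    0 on the edges in [S] and -1 on the other edges at [u]. It exposes the face spanned by [S];
    tilting it by the negative of a functional maximal at [u] selects the vertex of that face
    opposite to [u], which is [J(S)]. *)

Section DotProduct.
Variables (R : realType) (d : nat).
Local Notation V := 'rV[R]_d.
Implicit Types (u v w q : V) (s t : R).

Lemma dotC u v : dot u v = dot v u.
Proof. by apply: eq_bigr => i _; rewrite mulrC. Qed.

Lemma dotDl u v w : dot (u + v) w = dot u w + dot v w.
Proof. by rewrite -big_split; apply: eq_bigr => i _; rewrite mxE mulrDl. Qed.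

Lemma dotZl s u v : dot (s *: u) v = s * dot u v.
Proof. by rewrite /dot mulr_sumr; apply: eq_bigr => i _; rewrite mxE mulrA. Qed.

Lemma dotNl u v : dot (- u) v = - dot u v.
Proof. by rewrite -scaleN1r dotZl mulN1r. Qed.

Lemma dotDr u v w : dot w (u + v) = dot w u + dot w v.
Proof. by rewrite dotC dotDl !(dotC w). Qed.

Lemma dotZr s u v : dot u (s *: v) = s * dot u v.
Proof. by rewrite dotC dotZl dotC. Qed.

Lemma dotNr u v : dot u (- v) = - dot u v.
Proof. by rewrite dotC dotNl dotC. Qed.

Lemma dotBr u v w : dot w (u - v) = dot w u - dot w v.
Proof. by rewrite dotDr dotNr. Qed.

Lemma dot0r u : dot u 0 = 0.
Proof. by rewrite -(scale0r 0) dotZr mul0r. Qed.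

Lemma dot_sumr (I : Type) (r : seq I) (p : pred I) (F : I -> V) w :
  dot w (\sum_(i <- r | p i) F i) = \sum_(i <- r | p i) dot w (F i).
Proof.
by elim/big_rec2 : _ => [|i s v _ <-]; [exact: dot0r|exact: dotDr].
Qed.

Lemma dotxx_ge0 u : 0 <= dot u u.
Proof. by apply: sumr_ge0 => i _; rewrite -expr2 sqr_ge0. Qed.

Lemma dotxx_eq0 u : (dot u u == 0) = (u == 0).
Proof.
apply/eqP/eqP => [/eqP|->]; last by rewrite dot0r.
rewrite psumr_eq0 => [/allP h|i _]; last by rewrite -expr2 sqr_ge0.
apply/rowP => i; rewrite mxE; apply/eqP; have := h i (mem_index_enum _).
by rewrite /= mulf_eq0 orbb.
Qed.

Lemma dotxx_gt0 u : (0 < dot u u) = (u != 0).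
Proof. by rewrite lt_def dotxx_ge0 andbT dotxx_eq0. Qed.

(** A large multiple of [q] outweighs [w] wherever [q] does not vanish, so [w] only breaks the ties
    of [q]. *)
Lemma lex_perturbation (I : finType) (z : I -> V) q w :
  exists M : R, forall i,
    (0 < dot q (z i) -> 0 < dot (M *: q + w) (z i)) /\
    (dot q (z i) < 0 -> dot (M *: q + w) (z i) < 0).
Proof.
(* Exceeds every single ratio strictly; terms with zero denominator count as 0. *)
pose M := 1 + \sum_i `|dot w (z i)| / `|dot q (z i)|.
exists M => i; have [->|qn0] := eqVneq (dot q (z i)) 0; first by rewrite ltxx.
have bound : `|dot w (z i)| < M * `|dot q (z i)|.
  have q0 : 0 < `|dot q (z i)| by rewrite normr_gt0.
  rewrite -ltr_pdivrMr // /M (bigD1 i) //= addrCA ltr_pwDr //.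
  by rewrite ltr_pwDl // sumr_ge0 // => j _; rewrite divr_ge0.
have := ler_norm (dot w (z i)); have := ler_norm (- dot w (z i)); rewrite normrN.
split=> qi; rewrite dotDl dotZl.
  by move: bound; rewrite (gtr0_norm qi); lra.
by move: bound; rewrite (ltr0_norm qi); lra.
Qed.

(** Vectors are treated one at a time: if the current [h] vanishes on the new one, it is perturbed
    towards that vector, which has positive product with itself. *)
Lemma exists_regular (I : finType) (z : I -> V) : (forall i, z i != 0) ->
  exists h, forall i, dot h (z i) != 0.
Proof.
move=> z0.
suff [h hz] : exists h, forall i, i \in enum I -> dot h (z i) != 0.
  by exists h => i; rewrite hz // mem_enum.
elim: (enum I) => [|i s [h hs]]; first by exists 0.
have [hi|hi] := eqVneq (dot h (z i)) 0; last first.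
  by exists h => j; rewrite inE => /orP[/eqP -> //|/hs].
have [M HM] := lex_perturbation z h (z i).
exists (M *: h + z i) => j; rewrite inE => /orP[/eqP ->|/hs].
  by rewrite dotDl dotZl hi mulr0 add0r gt_eqF // dotxx_gt0.
by have [Hp Hn] := HM j; rewrite !neq_lt => /orP[/Hn ->|/Hp ->] //; rewrite orbT.
Qed.

(* Induction on the number of vectors: if [q] is positive on the others but
   negative on [h i], project the others along [h i] into [q]^perp. *)
Lemma gordan (I : finType) (s : seq I) (h : I -> V) : uniq s ->
  (exists q, forall i, i \in s -> 0 < dot q (h i)) \/
  (exists l : I -> R, [/\ forall i, 0 <= l i, exists2 i, i \in s & l i != 0 &
     \sum_(i <- s) l i *: h i = 0]).
Proof.
elim: s h => [|i s IHs] h /=; first by left; exists 0.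
case/andP=> is_ us.
have ns j : j \in s -> (j == i) = false by move=> js; apply: contraNF is_ => /eqP <-.
(* A functional that is positive on the tail and zero on [h i] can be tilted towards [h i]. *)
have orth q : (forall j, j \in s -> 0 < dot q (h j)) -> dot q (h i) = 0 -> h i != 0 ->
    exists q, forall j, j \in i :: s -> 0 < dot q (h j).
  move=> qs qi hi; have [M HM] := lex_perturbation h q (h i).
  exists (M *: q + h i) => j; rewrite inE => /orP[/eqP ->|/qs]; last exact: (HM j).1.
  by rewrite dotDl dotZl qi mulr0 add0r dotxx_gt0.
have [[q qs]|[l [l0 [j js lj] lh]]] := IHs h us; last first.
  right; exists (fun j => if j == i then 0 else l j); split.
  - by move=> j'; case: ifP.
  - by exists j; rewrite ?inE ?js ?orbT // ns.
  rewrite big_cons eqxx scale0r add0r -[RHS]lh; apply: eq_big_seq => j' j's.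
  by rewrite ns.
have [hi|hi] := eqVneq (h i) 0.
  right; exists (fun j => (j == i)%:R); split.
  - by move=> j; rewrite ler0n.
  - by exists i; rewrite ?inE ?eqxx // oner_neq0.
  rewrite big_cons hi scaler0 add0r big_seq big1 // => j js.
  by rewrite ns // scale0r.
have [qi|qi|qi] := ltgtP (dot q (h i)) 0; last by left; exact: orth qi hi.
  pose c := - dot q (h i); have c0 : 0 < c by rewrite oppr_gt0.
  pose h' j := h j + (dot q (h j) / c) *: h i.
  have [[q' qs']|[l [l0 [j js lj] lh]]] := IHs h' us.
    (* This combination vanishes on [h i] and takes on [h j] the value of [q'] on the projection
       [h' j]. *)
    left; apply: (orth (q' + (dot q' (h i) / c) *: q)) => // [j js|].
      have := qs' j js; rewrite /h' dotDr dotZr dotDl dotZl.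
      by rewrite (_ : dot q (h j) / c * _ = dot q' (h i) / c * dot q (h j)) //; ring.
    by rewrite dotDl dotZl /c; field; rewrite lt_eqF.
  (* The coefficient of [h i] collects the multiples of [h i] added by the projections. *)
  right; exists (fun j => if j == i then \sum_(j <- s) l j * (dot q (h j) / c) else l j).
  split.
  - move=> j'; case: ifP => // _; rewrite big_seq; apply: sumr_ge0 => m ms.
    by rewrite mulr_ge0 // divr_ge0 // ltW // qs.
  - by exists j; rewrite ?inE ?js ?orbT // ns.
  rewrite big_cons eqxx -[RHS]lh scaler_suml -big_split; apply: eq_big_seq => m ms /=.
  by rewrite ns // /h' scalerDr scalerA addrC.
left; exists q => j; rewrite inE => /orP[/eqP -> //|]; exact: qs.
Qed.

Definition cone_over (I : finType) (g : I -> V) (B : {set I}) v : Prop :=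
  exists2 l : I -> R, (forall i, 0 <= l i) & v = \sum_(i in B) l i *: g i.

(* A minimal generating subset consists of extreme rays of the pointed cone. *)
Lemma extreme_rays (I : finType) (g : I -> V) w : (forall i, dot w (g i) < 0) ->
  exists2 B : {set I}, forall i, cone_over g B (g i) &
    forall i, i \in B -> exists2 q, dot q (g i) = 0 &
      forall j, j \in B -> j != i -> dot q (g j) < 0.
Proof.
move=> wg.
pose gen B := `[< forall i, cone_over g B (g i) >].
have genT : gen [set: I]%SET.
  apply/asboolP => i; exists (fun j => (j == i)%:R) => [j|]; first exact: ler0n.
  rewrite (bigD1 i) ?inE //= eqxx scale1r big1 ?addr0 // => j /andP[_ /negbTE ->].
  by rewrite scale0r.
have [B /minsetP[/asboolP Bgen Bmin]] := ex_minset (ex_intro gen _ genT).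
exists B => // i iB.
have gi0 : 0 < dot (g i) (g i).
  by rewrite dotxx_gt0; apply: contraTneq (wg i) => ->; rewrite dot0r ltxx.
pose p j := dot (g j) (g i) / dot (g i) (g i).
(* Minus the component of [g j] orthogonal to [g i]. Either some [q] is positive on all of these,
   and its part orthogonal to [g i] is the functional sought, or a relation among them expresses
   [g i] by the others. *)
pose h j := p j *: g i - g j.
have [|[q qh]|[l [l0 [j js lj] lh]]] := @gordan I (enum (B :\ i)%SET) h.
- exact: enum_uniq.
- exists (q - (dot q (g i) / dot (g i) (g i)) *: g i) => [|j jB ji].
    by rewrite dotDl dotNl dotZl divfK ?subrr // gt_eqF.
  have := qh j; rewrite mem_enum !inE ji => /(_ jB); rewrite /h dotBr dotZr.
  rewrite dotDl dotNl dotZl subr_gt0 -subr_lt0; congr (_ < _).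
  by rewrite /p (dotC (g j)); ring.
have lsum : \sum_(j in (B :\ i)%SET) l j *: g j = (\sum_(j in (B :\ i)%SET) l j * p j) *: g i.
  apply/eqP; rewrite eq_sym -subr_eq0 scaler_suml -sumrB -big_enum -[X in _ == X]lh.
  by apply/eqP; apply: eq_bigr => m _; rewrite /h scalerBr scalerA.
set mu := \sum_(j in _) l j * p j in lsum.
(* Apply [w], which is negative on every [g j], to both sides of [lsum]. *)
have mu0 : 0 < mu.
  have : \sum_(j in (B :\ i)%SET) l j * - dot w (g j) = mu * - dot w (g i).
    have := congr1 (dot w) lsum; rewrite dot_sumr dotZr mulrN => <-.
    by rewrite -sumrN; apply: eq_bigr => m _; rewrite dotZr mulrN.
  have pos m : 0 < - dot w (g m) by rewrite oppr_gt0.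
  move=> E; rewrite -(pmulr_lgt0 _ (pos i)) -E lt_def psumr_neq0; last first.
    by move=> m _; rewrite mulr_ge0 // ltW.
  rewrite sumr_ge0 ?andbT; last by move=> m _; rewrite mulr_ge0 // ltW.
  apply/hasP; exists j; first exact: mem_index_enum.
  by rewrite -mem_enum js mulr_gt0 // lt_def lj l0.
have gi : g i = \sum_(j in (B :\ i)%SET) (l j / mu) *: g j.
  apply: (@scalerI _ _ mu); first by rewrite gt_eqF.
  rewrite -lsum scaler_sumr; apply: eq_bigr => m _.
  by rewrite scalerA mulrC divfK // gt_eqF.
(* Substituting the expression for [g i] gives a smaller generating set, against minimality. *)
have : gen (B :\ i)%SET.
  apply/asboolP => m; have [nu nu0 ->] := Bgen m.
  exists (fun j => nu j + nu i * (l j / mu)) => [j'|].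
    by rewrite addr_ge0 // mulr_ge0 // divr_ge0 // ltW.
  rewrite (big_setD1 i iB) /= {1}gi scaler_sumr -big_split; apply: eq_bigr => j' _ /=.
  by rewrite scalerA -scalerDl addrC.
move=> /Bmin/(_ (subD1set _ _)) BE; move: iB; rewrite -BE !inE eqxx.
by [].
Qed.

(** The dimension bound makes the family free, so its coordinate functions are available; [q]
    represents their combination with coefficients [rho]. *)
Lemma free_dual (I : finType) (g : I -> V) (B : {set I}) (rho : I -> R) :
  (#|B| <= \dim <<[seq g i | i <- enum B]>>)%N ->
  exists q, forall i, i \in B -> dot q (g i) = rho i.
Proof.
move=> dimB; pose X := map_tuple g (enum_tuple B).
have freeX : free X.
  by rewrite /free eqn_leq dim_span /= size_map -cardE.
pose q : V := \row_j \sum_(l < #|B|) rho (enum_val l) * coord X l (delta_mx 0 j).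
have qE v : dot q v = \sum_(l < #|B|) rho (enum_val l) * coord X l v.
  rewrite {2}(row_sum_delta v) /dot.
  under [RHS]eq_bigr do rewrite linear_sum mulr_sumr.
  rewrite exchange_big; apply: eq_bigr => j _; rewrite mxE mulr_suml.
  by apply: eq_bigr => l _; rewrite linearZ /= mulrCA mulrC mulrA mulrC.
exists q => i iB; rewrite qE.
have iE : g i = X`_(enum_rank_in iB i).
  by rewrite (nth_map i) -?cardE ?ltn_ord // -(enum_val_nth i) enum_rankK_in.
rewrite iE (bigD1 (enum_rank_in iB i)) //= coord_free // eqxx mulr1 enum_rankK_in //.
rewrite big1 ?addr0 // => l lr.
by rewrite coord_free // eq_sym (negbTE lr) mulr0.
Qed.

End DotProduct.

(** * Order complexes and subset carriers *)

Section ContinuityAtAPoint.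
Context {R : realType} {Z : topologicalType} (z0 : Z).
Implicit Types F G : Z -> R.

Lemma ptws_continuous (T : choiceType) (F : Z -> {ptws T -> R}) :
  (forall x, {for z0, continuous (fun z => F z x)}) -> {for z0, continuous F}.
Proof.
move=> Fc; apply/cvg_sup => x.
move=> U; rewrite nbhsE /= => -[V [[C oC <-] CV] VU].
have := Fc x C; rewrite nbhs_simpl => FC.
suff : \forall z \near z0, C (F z x).
  by apply: filterS => z Cz; apply: VU.
by apply: Fc; apply: open_nbhs_nbhs.
Qed.

Lemma mx_continuous n (F : Z -> 'rV[R]_n) :
  (forall i, {for z0, continuous (fun z => F z 0 i)}) -> {for z0, continuous F}.
Proof.
move=> Fc U [P MP PU].
have : \forall z \near z0, forall i, P 0 i (F z 0 i).
  by apply: filter_forall => i; exact: (Fc i _ (MP 0 i)).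
apply: filterS => z Pz; apply: PU => i j; rewrite (ord1 i); exact: Pz.
Qed.

Lemma coord_continuous_at n (F : Z -> 'rV[R]_n) i :
  {for z0, continuous F} -> {for z0, continuous (fun z => F z 0 i)}.
Proof.
move=> Fc; have h := @coord_continuous R 1 n 0 i (F z0).
exact: (cvg_comp _ (fun M : 'rV[R]_n => M 0 i) Fc h).
Qed.

Lemma continuous_big_at (op : R -> R -> R) (idx : R)
    (I : Type) (r : seq I) (p : pred I) (F : I -> Z -> R) :
  (forall G H, {for z0, continuous G} -> {for z0, continuous H} ->
     {for z0, continuous (fun z => op (G z) (H z))}) ->
  (forall i, {for z0, continuous (F i)}) ->
  {for z0, continuous (fun z => \big[op/idx]_(i <- r | p i) F i z)}.
Proof.
move=> op_cont F_cont; elim: r => [|i r IHr].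
  rewrite (_ : (fun z => _) = fun=> idx); first exact: cst_continuous.
  by apply/funext => z; rewrite big_nil.
have [pi|npi] := boolP (p i).
  rewrite (_ : (fun z => _) = fun z => op (F i z) (\big[op/idx]_(j <- r | p j) F j z)).
    exact: op_cont.
  by apply/funext => z; rewrite big_cons pi.
rewrite (_ : (fun z => _) = fun z => \big[op/idx]_(j <- r | p j) F j z) //.
by apply/funext => z; rewrite big_cons (negbTE npi).
Qed.

Lemma continuous_sum_at (I : Type) (r : seq I) (p : pred I) (F : I -> Z -> R) :
  (forall i, {for z0, continuous (F i)}) ->
  {for z0, continuous (fun z => \sum_(i <- r | p i) F i z)}.
Proof. by apply: continuous_big_at => G H; exact: (@continuousD _ R^o). Qed.

Lemma continuous_prod_at (I : Type) (r : seq I) (p : pred I) (F : I -> Z -> R) :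
  (forall i, {for z0, continuous (F i)}) ->
  {for z0, continuous (fun z => \prod_(i <- r | p i) F i z)}.
Proof. by apply: continuous_big_at => G H; exact: continuousM. Qed.

Lemma continuous_bigmin_at (I : Type) (r : seq I) (p : pred I) (F : I -> Z -> R) :
  (forall i, {for z0, continuous (F i)}) ->
  {for z0, continuous (fun z => \big[Num.min/0]_(i <- r | p i) F i z)}.
Proof. by apply: continuous_big_at => G H; exact: continuous_min. Qed.

End ContinuityAtAPoint.

Lemma ptws_eval_continuous (R : realType) (T : choiceType) (x : T)
    (a : {ptws T -> R}) :
  {for a, continuous (fun b : {ptws T -> R} => b x)}.
Proof. exact: (@proj_continuous T (fun=> R) x a). Qed.

Lemma continuous_within_at (X Y : topologicalType) (A : set X) (f : X -> Y) :
  (forall x, A x -> {for x, continuous f}) -> {within A, continuous f}.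
Proof. by move=> fc; apply: continuous_in_subspaceT => x /set_mem /fc. Qed.

Lemma lin_combE (R : realType) n (u v : 'rV[R]_n) (s t : R) i :
  (s *: u + t *: v) 0 i = s * u 0 i + t * v 0 i.
Proof. by rewrite !mxE. Qed.

(** * Points of a realization, described by their support *)

Section SupportMaps.
Variables (R : realType) (T : choiceType) (le : T -> T -> Prop) (r : seq T).
Implicit Types (a : {ptws T -> R}) (N : T -> R) (x y : T).

(** Reads the conditions off the support of [a], so that no witnessing simplex has to be carried
    along. *)
Definition in_realization a : Prop :=
  [/\ forall x, 0 <= a x, forall x, a x != 0 -> x \in r,
      forall x y, a x != 0 -> a y != 0 -> le x y \/ le y x &
      \sum_(x <- r) a x = 1].

Hypothesis r_uniq : uniq r.

Lemma realizationP a :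
  realization R (order_complex le [set x | x \in r]) a <-> in_realization a.
Proof.
split=> [[s [sr s_chain] [a0 as0 a1]]|[a0 ar ac a1]].
  have as_ x : a x != 0 -> x \in s.
    by apply: contra_neqT => /as0.
  split=> // [x /as_ /sr //|x y /as_ xs /as_ ys|]; first exact: s_chain.
  rewrite -a1 (bigID (mem s)) /= [X in _ + X]big1 ?addr0; last first.
    by move=> x /as0.
  have rs : perm_eq [seq x <- r | x \in s] (enum_fset s).
    apply: uniq_perm; rewrite ?filter_uniq ?fset_uniq // => x.
    by rewrite mem_filter andb_idr // => /sr.
  by rewrite -big_filter (perm_big _ rs).
exists [fset x in r | a x != 0]%fset; first split=> [x|x y].
- by rewrite !inE /= => /andP[].
- by rewrite !inE /= => /andP[_ xa] /andP[_ ya]; exact: ac.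
split=> // [x|].
  rewrite !inE /= negb_and negbK => /orP[|/eqP //].
  by apply: contraNeq => /ar.
rewrite -a1 [RHS](bigID (fun x => a x != 0)) /= [X in _ + X]big1 ?addr0; last first.
  by move=> x /negPn/eqP.
rewrite -[RHS]big_filter; apply: perm_big.
apply: uniq_perm; rewrite ?filter_uniq ?fset_uniq // => x.
by rewrite mem_filter !inE andbC.
Qed.

Definition normalized N : {ptws T -> R} := fun x => N x / \sum_(y <- r) N y.

Lemma normalized_total_gt0 N : (forall x, 0 <= N x) ->
  (exists2 x, x \in r & N x != 0) -> 0 < \sum_(y <- r) N y.
Proof.
move=> N0 [x xr Nx]; rewrite lt_def sumr_ge0 // andbT psumr_neq0 //.
by apply/hasP; exists x => //=; rewrite lt_def Nx N0.
Qed.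

Lemma normalized_in_realization N : (forall x, 0 <= N x) ->
  (exists x, N x != 0) -> (forall x, N x != 0 -> x \in r) ->
  (forall x y, N x != 0 -> N y != 0 -> le x y \/ le y x) ->
  in_realization (normalized N).
Proof.
move=> N0 [x0 Nx0] Nr Nc.
have tot : 0 < \sum_(y <- r) N y.
  by apply: normalized_total_gt0 => //; exists x0 => //; exact: Nr.
have nz x : normalized N x != 0 -> N x != 0.
  by apply: contra_neq => N_0; rewrite /normalized N_0 mul0r.
split=> [x|x /nz /Nr //|x y /nz ? /nz|]; last 2 first.
- exact: Nc.
- by rewrite -mulr_suml divff // gt_eqF.
- by rewrite divr_ge0 // ltW.
Qed.

Lemma normalized_id a : in_realization a -> normalized a = a.
Proof. by case=> _ _ _ a1; apply/funext => x; rewrite /normalized a1 divr1. Qed.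

Lemma normalized_continuous (Z : topologicalType) (z0 : Z) (N : Z -> T -> R) :
  \sum_(y <- r) N z0 y != 0 ->
  (forall x : T, {for z0, continuous (fun z => N z x)}) ->
  {for z0, continuous (fun z => normalized (N z))}.
Proof.
move=> tot Nc; apply: ptws_continuous => x.
have Nx : {for z0, continuous (fun z => (\sum_(y <- r) N z y)^-1)}.
  by apply: continuousV => //; exact: continuous_sum_at.
exact: continuousM (Nc x) Nx.
Qed.

End SupportMaps.

(** * Chains compared with vectors on a finite index set *)

Section SubsetCarrier.
Variables (R : realType) (T : choiceType) (le : T -> T -> Prop) (r : seq T).
Variables (k : nat) (A : T -> {set 'I_k}) (J : {set 'I_k} -> T).
Variable ok : pred {set 'I_k}.
Implicit Types (a : {ptws T -> R}) (m : T -> R) (x y : T).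
Implicit Types (b : 'rV[R]_k) (S : {set 'I_k}) (i j : 'I_k) (t : R).

Hypothesis r_uniq : uniq r.
Hypothesis le_trans : forall x y w, le x y -> le y w -> le x w.
Hypothesis le_anti : forall x y, le x y -> le y x -> x = y.
Hypothesis A_mono : forall x y, x \in r -> y \in r -> le x y -> A x \subset A y.
Hypothesis A_ok : forall x, x \in r -> ok (A x).
Hypothesis ok_neq0 : forall S, ok S -> S != finset.set0.
Hypothesis ok_sub :
  forall S S', ok S -> S' != finset.set0 -> S' \subset S -> ok S'.
Hypothesis J_r : forall S, ok S -> J S \in r.
Hypothesis J_mono : forall S S', ok S -> ok S' -> S \subset S' -> le (J S) (J S').
Hypothesis JA_le : forall x, x \in r -> le (J (A x)) x.
Hypothesis AJ_sub : forall S, ok S -> A (J S) \subset S.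

(* [cone] is the cone over the simplicial complex of the [ok] subsets of 'I_k;
   [phi] maps the realization into it, and [psi] maps it back, onto the chain of
   the [J S] for [S] an [ok] strict superlevel set of [b]. *)
Definition phi m : 'rV[R]_k := \row_i \sum_(x <- r | i \in A x) m x.

(** A continuous indicator of strict superlevel sets. The double product vanishes once an entry
    outside [S] reaches one inside; the last product demands positivity on [S], which also controls
    the full set, where the double product is empty. The empty set has weight 1 and is excluded by
    [ok]. *)
Definition weight b S : R :=
  (\prod_(i in S) \prod_(j in ~: S) Num.max 0 (b 0 i - b 0 j)) *
  \prod_(i in S) Num.max 0 (b 0 i).

Definition prepsi b x : R := \sum_(S | ok S && (J S == x)) weight b S.

Definition psi b : {ptws T -> R} := normalized r (prepsi b).

Definition cone b : Prop :=
  (forall i, 0 <= b 0 i) /\ ok (finset (fun i => 0 < b 0 i)).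

Lemma max0_neq0 (s : R) : (Num.max 0 s != 0) = (0 < s).
Proof. by case: (ltgtP 0 s); rewrite ?eqxx // => /gt_eqF ->. Qed.

Lemma weight_ge0 b S : 0 <= weight b S.
Proof.
apply: mulr_ge0; last by apply: prodr_ge0 => i _; rewrite le_max lexx.
by apply: prodr_ge0 => i _; apply: prodr_ge0 => j _; rewrite le_max lexx.
Qed.

Lemma weight_neq0 b S : weight b S != 0 <->
  (forall i, i \in S -> 0 < b 0 i) /\
  (forall i j, i \in S -> j \notin S -> b 0 j < b 0 i).
Proof.
rewrite /weight mulf_eq0 negb_or; split=> [/andP[/prodf_neq0 w1 /prodf_neq0 w2]|[b0 bS]].
  split=> [i iS|i j iS jS]; first by rewrite -max0_neq0 w2.
  have /prodf_neq0/(_ j) := w1 i iS.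
  by rewrite finset.in_setC max0_neq0 subr_gt0; exact.
apply/andP; split; apply/prodf_neq0 => i iS; last by rewrite max0_neq0 b0.
apply/prodf_neq0 => j; rewrite finset.in_setC => jS.
by rewrite max0_neq0 subr_gt0 bS.
Qed.

(** Superlevel sets of one function are nested: indices in both differences would each have the
    larger value. *)
Lemma weight_chain b S S' : weight b S != 0 -> weight b S' != 0 ->
  S \subset S' \/ S' \subset S.
Proof.
move=> /weight_neq0[_ bS] /weight_neq0[_ bS'].
have [|/fintype.subsetPn[i iS iS']] := boolP (S \subset S'); first by left.
right; apply/fintype.subsetP => j jS'; apply: contraT => jS.
by have := lt_trans (bS _ _ iS jS) (bS' _ _ jS' iS'); rewrite ltxx.
Qed.

Lemma prepsi_ge0 b x : 0 <= prepsi b x.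
Proof. by apply: sumr_ge0 => S _; exact: weight_ge0. Qed.

Lemma prepsi_neq0 b x : prepsi b x != 0 <->
  exists S, [/\ ok S, J S = x & weight b S != 0].
Proof.
rewrite /prepsi psumr_neq0; last by move=> S _; exact: weight_ge0.
split=> [/hasP[S _ /andP[/andP[okS /eqP JS] wS]]|[S [okS JS wS]]].
  by exists S; rewrite gt_eqF.
apply/hasP; exists S; first by rewrite mem_index_enum.
by rewrite okS JS eqxx lt_def wS weight_ge0.
Qed.

(** The set of indices where [b] is maximal always has weight, so [psi] never divides by zero. *)
Lemma cone_prepsi b : cone b -> exists x, prepsi b x != 0.
Proof.
move=> [b0 okb]; have /finset.set0Pn[i0] := ok_neq0 okb.
rewrite inE => bi0.
pose S := finset (fun i => [forall j, b 0 j <= b 0 i]).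
have Spos i : i \in S -> 0 < b 0 i.
  by rewrite inE => /forallP/(_ i0); exact: lt_le_trans.
exists (J S); apply/prepsi_neq0; exists S; split=> //.
  apply: ok_sub okb _ _; last first.
    by apply/fintype.subsetP => i iS; rewrite inE Spos.
  apply/finset.set0Pn.
    case: (@Order.TotalTheory.arg_maxP _ _ _ i0 xpredT (fun i => b 0 i)) => // i _ imax.
  by exists i; rewrite inE; apply/forallP => j; exact: imax.
apply/weight_neq0; split=> // i j; rewrite !inE => /forallP iS /forallPn[l].
by rewrite -ltNge => /lt_le_trans; apply.
Qed.

Lemma psi_in_realization b : cone b -> in_realization le r (psi b).
Proof.
move=> bc; apply: normalized_in_realization => //; first exact: prepsi_ge0.
- exact: cone_prepsi.
- by move=> x /prepsi_neq0[S [okS <- _]]; exact: J_r.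
move=> x y /prepsi_neq0[S [okS <- wS]] /prepsi_neq0[S' [okS' <- wS']].
by have [SS'|S'S] := weight_chain wS wS'; [left|right]; exact: J_mono.
Qed.

Lemma cone_scale (l : R) b : 0 < l -> cone b -> cone (l *: b).
Proof.
move=> l0 [b0 okb]; split=> [i|]; first by rewrite mxE mulr_ge0 // ltW.
rewrite (_ : finset _ = finset (fun i => 0 < b 0 i)) //.
by apply/setP => i; rewrite !inE mxE pmulr_rgt0.
Qed.

Lemma phiB m i j : phi m 0 j - phi m 0 i =
  \sum_(x <- r) ((if j \in A x then m x else 0) - (if i \in A x then m x else 0)).
Proof. by rewrite !mxE big_mkcond [X in _ - X]big_mkcond -sumrB. Qed.

Lemma phi_neq0 m i : phi m 0 i != 0 -> exists x, [/\ x \in r, i \in A x & m x != 0].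
Proof.
rewrite mxE => h; apply: contrapT => nx; case/eqP: h.
rewrite big_seq_cond big1 // => x /andP[xr ix]; apply/eqP/negPn/negP => mx.
by apply: nx; exists x.
Qed.

(** Along a chain the sets [A x] are nested, so extremal cardinality means extremal for
    inclusion. *)
Lemma exists_extremal_card (p : pred T) :
  (exists2 x, x \in r & p x) ->
  (exists x, [/\ x \in r, p x & forall y, y \in r -> p y -> #|A x| <= #|A y|]%N) /\
  (exists x, [/\ x \in r, p x & forall y, y \in r -> p y -> #|A y| <= #|A x|]%N).
Proof.
move=> [x1 x1r px1].
pose q n := has (fun x => p x && (#|A x| == n)) r.
have exq : exists n, q n by exists #|A x1|; apply/hasP; exists x1; rewrite // px1 /=.
have qk n : q n -> (n <= k)%N.
  by case/hasP => x _ /andP[_ /eqP <-]; rewrite -[X in (_ <= X)%N]card_ord max_card.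
split.
  case: (ex_minnP exq) => n /hasP[x xr /andP[px /eqP <-]] nmin; exists x; split=> // y yr py.
  by apply: nmin; apply/hasP; exists y; rewrite // py /=.
case: (ex_maxnP exq qk) => n /hasP[x xr /andP[px /eqP <-]] nmax; exists x; split=> // y yr py.
by apply: nmax; apply/hasP; exists y; rewrite // py /=.
Qed.

(** Total mass is left free, so that the notion applies to the moved part of a point. *)
Definition supported_on_chain m : Prop :=
  [/\ forall x, 0 <= m x, forall x, m x != 0 -> x \in r &
      forall x y, m x != 0 -> m y != 0 -> le x y \/ le y x].

Lemma A_comparable m x y : supported_on_chain m -> m x != 0 -> m y != 0 ->
  A x \subset A y \/ A y \subset A x.
Proof.
move=> [_ mr mc] mx my.
by have [h|h] := mc _ _ mx my; [left|right]; apply: A_mono => //; exact: mr.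
Qed.

(* [x] is the first point of the chain whose [A x] contains an index of [S] at
   which [phi m] is minimal. *)
Lemma superlevel_support m S (l : R) : supported_on_chain m -> S != finset.set0 -> 0 < l ->
  weight (l *: phi m) S != 0 -> exists2 x, m x != 0 & A x = S.
Proof.
move=> mch /finset.set0Pn[i1 i1S] l0 /weight_neq0[w0 wS].
have [m0 mr _] := mch.
have {}w0 i : i \in S -> 0 < phi m 0 i by move=> /w0; rewrite mxE pmulr_rgt0.
have {}wS i j : i \in S -> j \notin S -> phi m 0 j < phi m 0 i.
  by move=> iS jS; have := wS _ _ iS jS; rewrite !(mxE scalemx_key) ltr_pM2l.
case: (@Order.TotalTheory.arg_minP _ _ _ i1 (mem S) (fun i => phi m 0 i)) => // i0 i0S imin.
have [x1 [x1r ix1 mx1]] : exists x, [/\ x \in r, i0 \in A x & m x != 0].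
  by apply: phi_neq0; rewrite gt_eqF // w0.
have [[x0 [x0r /andP[ix0 mx0] x0min]] _] :=
  @exists_extremal_card (fun x => (i0 \in A x) && (m x != 0))
    (ex_intro2 _ _ x1 x1r (introT andP (conj ix1 mx1))).
have x0sub x : m x != 0 -> i0 \in A x -> A x0 \subset A x.
  move=> mx ix; have [//|h] := A_comparable mch mx0 mx.
  have c : (#|A x0| <= #|A x|)%N by apply: x0min; rewrite ?mr // ix.
  by have /eqP -> : A x == A x0 by rewrite eqEcard h.
exists x0 => //; apply/eqP; rewrite finset.eqEsubset; apply/andP; split.
  (* Every point of the chain that counts for [i0] counts for [j], so [phi m] is at least as large
     at [j] as at [i0]. *)
  apply/fintype.subsetP => j jx0; apply: contraT => jS.
  have := wS _ _ i0S jS; rewrite -subr_gt0 phiB ltNge => /negP[].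
  apply: sumr_le0 => x _; case: ifP => [i0x|_]; last by case: ifP => //; rewrite sub0r oppr_le0.
  have [->|mx] := eqVneq (m x) 0; first by case: ifP; rewrite subr0.
  by rewrite (fintype.subsetP (x0sub x mx i0x) j jx0) subrr.
(* Every point that counts for [i] counts for [i0], and [x0] counts only for [i0]; hence [phi m]
   would be smaller at [i] than its minimum over [S]. *)
apply/fintype.subsetP => i iS; apply: contraT => ix0'.
have := imin i iS; rewrite leNgt => /negP[]; rewrite -subr_gt0 phiB.
have dom x : m x != 0 -> i \in A x -> i0 \in A x.
  move=> mx ix; have [h|h] := A_comparable mch mx0 mx.
    exact: (fintype.subsetP h).
  by move: ix0'; rewrite (fintype.subsetP h).
apply: normalized_total_gt0; last by exists x0; rewrite // ix0 (negbTE ix0') subr0.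
move=> x; have [->|mx] := eqVneq (m x) 0; first by rewrite !if_same subrr.
have [ix|_] := boolP (i \in A x); first by rewrite dom // subrr.
by rewrite subr0; case: ifP.
Qed.

Lemma in_realization_supported a : in_realization le r a -> supported_on_chain a.
Proof. by case=> a0 ar ac _; split. Qed.

Lemma in_realization_neq0 a : in_realization le r a -> exists2 x, x \in r & a x != 0.
Proof.
case=> a0 _ _ a1; have : \sum_(x <- r) a x != 0 by rewrite a1 oner_neq0.
by rewrite psumr_neq0 // => /hasP[x xr ax]; exists x; rewrite // gt_eqF.
Qed.

Lemma phi_ge0 m i : (forall x, 0 <= m x) -> 0 <= phi m 0 i.
Proof. by move=> m0; rewrite mxE sumr_ge0. Qed.

Lemma phi_gt0 m x i : (forall y, 0 <= m y) -> x \in r -> i \in A x -> m x != 0 ->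
  0 < phi m 0 i.
Proof.
move=> m0 xr ix mx; rewrite mxE big_mkcond; apply: normalized_total_gt0.
  by move=> y; case: ifP.
by exists x; rewrite // ix.
Qed.

(** All positive coordinates of [phi a] lie in the largest [A x] over the support of [a], and [ok]
    passes to nonempty subsets. *)
Lemma phi_cone a : in_realization le r a -> cone (phi a).
Proof.
move=> aY; have [a0 ar ac _] := aY; split=> [i|]; first exact: phi_ge0.
have [_ [x [xr ax xmax]]] := exists_extremal_card (in_realization_neq0 aY).
apply: (ok_sub (A_ok xr)).
  have /finset.set0Pn[i ix] := ok_neq0 (A_ok xr).
  by apply/finset.set0Pn; exists i; rewrite inE (phi_gt0 a0 xr ix).
apply/fintype.subsetP => i; rewrite inE => /lt0r_neq0/phi_neq0[y [yr iy ay]].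
have [h|h] := A_comparable (in_realization_supported aY) ax ay; last exact: (fintype.subsetP h).
by have /eqP -> : A x == A y by rewrite eqEcard h xmax.
Qed.

(** The support of [psi b] consists of points [J S] with [b] positive on [S], and [A (J S)] stays
    inside [S]. *)
Lemma phi_psi_supported b i : cone b -> phi (psi b) 0 i != 0 -> 0 < b 0 i.
Proof.
move=> bc /phi_neq0[x [xr ix]].
have [px|] := eqVneq (prepsi b x) 0; first by rewrite /psi /normalized px mul0r eqxx.
move=> /prepsi_neq0[S [okS JS /weight_neq0[b0 _]]] _.
by apply: b0; apply: (fintype.subsetP (AJ_sub okS)); rewrite JS.
Qed.

Section Continuity.
Variables (Z : topologicalType) (z0 : Z).

Lemma phi_continuous (F : Z -> T -> R) :
  (forall x, {for z0, continuous (fun z => F z x)}) ->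
  {for z0, continuous (fun z => phi (F z))}.
Proof.
move=> Fc; apply: mx_continuous => i.
rewrite (_ : (fun z => _) = fun z => \sum_(x <- r | i \in A x) F z x).
  exact: continuous_sum_at.
by apply/funext => z; rewrite mxE.
Qed.

Lemma prepsi_continuous (F : Z -> 'rV[R]_k) x :
  {for z0, continuous F} -> {for z0, continuous (fun z => prepsi (F z) x)}.
Proof.
move=> Fc; have Fi (i : 'I_k) : {for z0, continuous (fun z => F z 0 i)}.
  exact: coord_continuous_at.
apply: continuous_sum_at => S; apply: continuousM.
  apply: continuous_prod_at => i; apply: continuous_prod_at => j.
  apply: continuous_max; first exact: cst_continuous.
  exact: (@continuousB _ R^o).
apply: continuous_prod_at => i.
by apply: continuous_max; first exact: cst_continuous.
Qed.

Lemma prepsi_total b : cone b -> \sum_(x <- r) prepsi b x != 0.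
Proof.
move=> bc; have [x px] := cone_prepsi bc; rewrite gt_eqF //.
apply: normalized_total_gt0; first exact: prepsi_ge0.
by exists x => //; have [S [okS <- _]] := (prepsi_neq0 b x).1 px; exact: J_r.
Qed.

Lemma psi_continuous (F : Z -> 'rV[R]_k) : cone (F z0) ->
  {for z0, continuous F} -> {for z0, continuous (fun z => psi (F z))}.
Proof.
move=> Fz Fc; apply: normalized_continuous; first exact: prepsi_total.
by move=> x; exact: prepsi_continuous.
Qed.

End Continuity.

(** * Deformation of a chain from the bottom upwards *)

Definition below m x : R := \sum_(y <- r | `[< le y x >] && (y != x)) m y.

(* Order the mass of [m] along its chain, from the bottom; [moved t m x] is the
   part of the mass at [x] lying among the first [t] units. The points with moved
   mass precede those with unmoved mass, so replacing each moved [x] by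
   [J (A x)], which lies below [x], keeps the support a chain. *)
Definition moved t m x : R :=
  Num.min t (below m x + m x) - Num.min t (below m x).

Lemma below_ge0 m x : (forall y, 0 <= m y) -> 0 <= below m x.
Proof. by move=> m0; apply: sumr_ge0. Qed.

Lemma moved_bounds t m x : (forall y, 0 <= m y) -> 0 <= moved t m x <= m x.
Proof.
move=> m0; have := m0 x; have := below_ge0 x m0; rewrite /moved.
by case: (leP t (below m x + m x)); case: (leP t (below m x)) => *; lra.
Qed.

Lemma moved_eq0 t m x : (forall y, 0 <= m y) -> m x = 0 -> moved t m x = 0.
Proof.
by move=> m0 mx; apply/eqP; have := moved_bounds t x m0; rewrite mx -eq_le eq_sym.
Qed.

Lemma moved_neq0 t m x : (forall y, 0 <= m y) -> moved t m x != 0 -> m x != 0.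
Proof. by move=> m0; apply: contraNneq => /(moved_eq0 t m0) ->. Qed.

Lemma unmoved_neq0 t m x : (forall y, 0 <= m y) -> m x - moved t m x != 0 -> m x != 0.
Proof.
by move=> m0; apply: contraNneq => mx; rewrite (moved_eq0 t m0) // mx subrr.
Qed.

Lemma moved_supported t a : supported_on_chain a -> supported_on_chain (moved t a).
Proof.
move=> [a0 ar ac].
have nz x : moved t a x != 0 -> a x != 0 by exact: moved_neq0.
split=> [x|x /nz /ar //|x y /nz ax /nz]; last exact: ac.
by have /andP[] := moved_bounds t x a0.
Qed.

Lemma moved0 m : (forall x, 0 <= m x) -> moved 0 m = fun=> 0.
Proof.
move=> m0; apply/funext => x; have := m0 x; have := below_ge0 x m0; rewrite /moved => *.
by rewrite !min_l ?subrr //; lra.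
Qed.

Lemma below_add m x : x \in r -> below m x + m x =
  \sum_(y <- r) (if `[< le y x >] || (y == x) then m y else 0).
Proof.
move=> xr; rewrite /below big_mkcond /= !(bigD1_seq x xr r_uniq) /= eqxx orbT andbF add0r addrC.
by congr (_ + _); apply: eq_bigr => y yx; rewrite yx (negbTE yx) andbT orbF.
Qed.

(** With the mass stacked along the chain, [x] occupies the interval from [below m x] to
    [below m x + m x]; the intervals of distinct comparable points do not overlap. *)
Lemma below_lt m x y : (forall w, 0 <= m w) -> x \in r -> y \in r -> le y x -> y != x ->
  below m y + m y <= below m x.
Proof.
move=> m0 xr yr yx ynx; rewrite below_add // /below [leRHS]big_mkcond /=.
apply: ler_sum => w _.
have [/orP wy|_] := boolP (_ || _); last by case: ifP.
suff [wx wnx] : le w x /\ w != x by rewrite wnx andbT; case: asboolP.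
case: wy => [/asboolP wy|/eqP -> //]; split; first exact: le_trans yx.
by apply: contraNneq ynx => wx; apply/eqP/le_anti; rewrite // -wx.
Qed.

Lemma moved1 a : in_realization le r a -> moved 1 a = a.
Proof.
move=> [a0 ar _ a1]; apply/funext => x; rewrite /moved.
have [ax|ax] := eqVneq (a x) 0; first by rewrite ax addr0 subrr.
have := below_ge0 x a0; have := a0 x.
have : below a x + a x <= 1.
  by rewrite -a1 below_add ?ar //; apply: ler_sum => y _; case: ifP.
by move=> *; rewrite !min_r; lra.
Qed.

(** The interval of [x] starts before level [t] and that of [y] ends after it, so [y] cannot lie
    strictly below [x]. *)
Lemma moved_unmoved t m x y : (forall w, 0 <= m w) -> x \in r -> y \in r ->
  moved t m x != 0 -> m y - moved t m y != 0 -> le y x -> y = x.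
Proof.
move=> m0 xr yr mx my yx; apply/eqP; apply: contraT => ynx.
have := below_lt m0 xr yr yx ynx; have := m0 x; have := m0 y.
have := below_ge0 y m0.
have tx : below m x < t.
  rewrite ltNge; apply: contraNN mx => tx; rewrite /moved !min_l ?subrr //.
  by rewrite (Order.POrderTheory.le_trans tx) // lerDl.
have ty : t < below m y + m y.
  rewrite ltNge; apply: contraNN my => ty.
  rewrite /moved !min_r //; last by rewrite (Order.POrderTheory.le_trans _ ty) // lerDl.
  by rewrite addrAC subrr add0r subrr.
lra.
Qed.

(** The factor [l] absorbs the rescaling produced by a passage through the ball or the sphere, so
    that the fully moved stage is exactly the composite map. *)
Definition push (l t : R) m x : R := m x - moved t m x + prepsi (l *: phi (moved t m)) x.

Lemma push_neq0 l t m x : push l t m x != 0 ->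
  m x - moved t m x != 0 \/ prepsi (l *: phi (moved t m)) x != 0.
Proof.
have [h|] := eqVneq (m x - moved t m x) 0; last by left.
by rewrite /push h add0r; right.
Qed.

Lemma push_ge0 l t m x : (forall y, 0 <= m y) -> 0 <= push l t m x.
Proof.
move=> m0; apply: addr_ge0; last exact: prepsi_ge0.
by rewrite subr_ge0; have /andP[] := moved_bounds t x m0.
Qed.

Lemma push_exists l t a : in_realization le r a -> 0 < l -> exists x, push l t a x != 0.
Proof.
move=> aY l0; have [a0 _ _ _] := aY.
have [mv|/existsNP[x mx]] := pselect (forall x, moved t a x = a x).
  have [x px] := cone_prepsi (cone_scale l0 (phi_cone aY)).
  by exists x; rewrite /push mv subrr add0r (_ : moved t a = a) //; exact/funext.
have /andP[_ ma] := moved_bounds t x a0.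
exists x; rewrite gt_eqF // ltr_wpDr ?prepsi_ge0 // subr_gt0 lt_neqAle ma andbT.
exact/eqP.
Qed.

(** By [superlevel_support], the superlevel sets that receive weight are the [A y] of moved points
    [y]. *)
Lemma push_carrier l t a x : in_realization le r a -> 0 < l -> push l t a x != 0 ->
  (a x != 0 /\ a x - moved t a x != 0) \/
  (exists y, [/\ a y != 0, moved t a y != 0 & J (A y) = x]).
Proof.
move=> aY l0; have [a0 _ _ _] := aY.
move=> /push_neq0[ux|/prepsi_neq0[S [okS <- wS]]]; [left|right].
  by split=> //; exact: unmoved_neq0 ux.
have mch := moved_supported t (in_realization_supported aY).
have [y my <-] := superlevel_support mch (ok_neq0 okS) l0 wS; exists y; split=> //.
exact: moved_neq0 my.
Qed.

Lemma push_r l t a x : in_realization le r a -> 0 < l -> push l t a x != 0 -> x \in r.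
Proof.
move=> aY l0; have [a0 ar _ _] := aY.
by move=> /(push_carrier aY l0)[[/ar]|[y [/ar yr _ <-]]] //; exact/J_r/A_ok.
Qed.

Lemma push_in_realization l t a : in_realization le r a -> 0 < l ->
  in_realization le r (normalized r (push l t a)).
Proof.
move=> aY l0; have [a0 ar ac _] := aY.
(* The critical pair: the image of a moved point against an unmoved point, settled by
   [J (A x) <= x <= y]. *)
have mixed x y : a x != 0 -> moved t a x != 0 -> a y != 0 -> a y - moved t a y != 0 ->
    le (J (A x)) y.
  move=> ax mx ay uy; have xr := ar _ ax; have yr := ar _ ay.
  have [xy|yx] := ac _ _ ax ay; first exact: le_trans (JA_le xr) xy.
  by rewrite (moved_unmoved a0 xr yr mx uy yx); exact: JA_le.
apply: normalized_in_realization => //.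
- by move=> x; exact: push_ge0.
- exact: push_exists.
- by move=> x; exact: push_r.
move=> x y /(push_carrier aY l0)[[ax ux]|[x' [ax mx <-]]].
  move=> /(push_carrier aY l0)[[ay uy]|[y' [ay my <-]]]; first exact: ac.
  by right; exact: mixed.
move=> /(push_carrier aY l0)[[ay uy]|[y' [ay my <-]]]; first by left; exact: mixed.
by have [h|h] := A_comparable (in_realization_supported aY) ax ay; [left|right];
  apply: J_mono => //; exact/A_ok/ar.
Qed.

Local Notation Y := (in_realization le r).

Lemma push_homotopy (l : {ptws T -> R} -> R) :
  (forall a, Y a -> 0 < l a) -> (forall a, Y a -> {for a, continuous l}) ->
  homotopic_maps R (Y : set {ptws T -> R}) Y (fun a => psi (l a *: phi a)) id.
Proof.
move=> l0 lc.
(* Time is reversed: at 0 all the mass has been moved, at 1 none. *)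
exists (fun p : R * {ptws T -> R} => normalized r (push (l p.2) (1 - p.1) p.2)); split.
- apply: continuous_within_at => -[s a] [/= _ aY].
  have sndc : {for (s, a), continuous (@snd R {ptws T -> R})} by exact: cvg_snd.
  have ac x : {for (s, a), continuous (fun p : R * {ptws T -> R} => p.2 x)}.
    exact: (cvg_comp _ (fun b : {ptws T -> R} => b x) sndc (@ptws_eval_continuous R T x a)).
  have lc' : {for (s, a), continuous (fun p : R * {ptws T -> R} => l p.2)}.
    exact: (cvg_comp _ l sndc (lc a aY)).
  have sc : {for (s, a), continuous (fun p : R * {ptws T -> R} => 1 - p.1)}.
    by apply: (@continuousB _ R^o); [exact: cst_continuous|exact: cvg_fst].
  have mc x : {for (s, a), continuous (fun p : R * {ptws T -> R} => moved (1 - p.1) p.2 x)}.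
    have bc : {for (s, a), continuous (fun p : R * {ptws T -> R} => below p.2 x)}.
      exact: continuous_sum_at.
    apply: (@continuousB _ R^o); apply: continuous_min => //.
    exact: (@continuousD _ R^o).
  apply: normalized_continuous => [|x].
    rewrite gt_eqF // normalized_total_gt0 //.
      by move=> x; apply: push_ge0; case: aY.
    have [x px] := push_exists (1 - s) aY (l0 _ aY); exists x => //.
    exact: push_r aY (l0 _ aY) px.
  apply: (@continuousD _ R^o); first by apply: (@continuousB _ R^o).
  apply: prepsi_continuous; apply: mx_continuous => i.
  rewrite (_ : (fun z => _) =
    fun p : R * {ptws T -> R} => l p.2 * phi (moved (1 - p.1) p.2) 0 i); last first.
    by apply/funext => p; rewrite mxE.
  by apply: continuousM => //; apply: coord_continuous_at; exact: phi_continuous.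
- move=> t a _ aY; apply: push_in_realization => //; exact: l0.
- move=> a aY /=; rewrite subr0 /psi; congr normalized.
  by apply/funext => x; rewrite /push moved1 // subrr add0r.
move=> a aY /=; have [a0 _ _ _] := aY; rewrite subrr -[RHS](normalized_id aY).
congr normalized; apply/funext => x.
rewrite /push moved0 // subr0 (_ : prepsi _ x = 0) ?addr0 //.
(* At the zero vector no nonempty set has weight. *)
apply: contrapT => /eqP/prepsi_neq0[S [okS _ /weight_neq0[w0 _]]].
have /finset.set0Pn[i iS] := ok_neq0 okS.
by have := w0 i iS; rewrite !mxE big1 // mulr0 ltxx.
Qed.

(** Since [phi (psi b)] is supported inside the support of [b], so is the whole segment; it stays
    nonzero because both ends are positive at a common index. *)
Lemma phi_psi_segment_cone b (t : R) : cone b -> 0 <= t <= 1 ->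
  cone ((1 - t) *: phi (psi b) + t *: b).
Proof.
move=> bc /andP[t0 t1]; have [p0 okp] := phi_cone (psi_in_realization bc).
have [b0 okb] := bc.
have t1' : 0 <= 1 - t by rewrite subr_ge0.
split=> [i|]; first by rewrite lin_combE addr_ge0 // mulr_ge0.
apply: (ok_sub okb).
  have /finset.set0Pn[i ip] := ok_neq0 okp; apply/finset.set0Pn; exists i.
  move: ip; rewrite !inE => ip.
  have bi := phi_psi_supported bc (lt0r_neq0 ip).
  rewrite lin_combE.
  have [->|tn0] := eqVneq t 0; first by rewrite subr0 mul1r mul0r addr0.
  by rewrite ltr_wpDl ?mulr_ge0 ?p0 // mulr_gt0 // lt_def tn0.
apply/fintype.subsetP => i; rewrite !inE => ip; rewrite lt_def b0 andbT.
apply: contraTneq ip => bi; rewrite lin_combE bi mulr0 addr0.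
suff -> : phi (psi b) 0 i = 0 by rewrite mulr0 ltxx.
by apply: contra_eq bi => /(phi_psi_supported bc) /gt_eqF ->.
Qed.

(** * Passage from the cone to a concrete space *)

Section Model.
Variables (n : nat) (M : set 'rV[R]_n) (s : 'rV[R]_k -> 'rV[R]_n).
Variables (rho : 'rV[R]_n -> 'rV[R]_k) (l : 'rV[R]_k -> R).
Hypothesis s_continuous : forall b, cone b -> {for b, continuous s}.
Hypothesis s_M : forall b, cone b -> M (s b).
Hypothesis rho_continuous : forall y : 'rV[R]_n, M y -> {for y, continuous rho}.
Hypothesis rho_cone : forall y : 'rV[R]_n, M y -> cone (rho y).
Hypothesis l_continuous : forall b, cone b -> {for b, continuous l}.
Hypothesis l_gt0 : forall b, cone b -> 0 < l b.
Hypothesis rho_s : forall b, cone b -> rho (s b) = l b *: b.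

Lemma psi_rho_continuous (y : 'rV[R]_n) : M y ->
  {for y, continuous (fun v => psi (rho v))}.
Proof. by move=> yM; apply: psi_continuous; [exact: rho_cone|exact: rho_continuous]. Qed.

Lemma phi_continuous_at a : {for a, continuous (phi : {ptws T -> R} -> 'rV[R]_k)}.
Proof. by apply: phi_continuous => x; exact: ptws_eval_continuous. Qed.

Lemma phi_psi_rho_continuous (y : 'rV[R]_n) : M y ->
  {for y, continuous (fun v => phi (psi (rho v)))}.
Proof.
move=> yM.
exact: (cvg_comp _ (phi : {ptws T -> R} -> 'rV[R]_k) (psi_rho_continuous yM) (@phi_continuous_at _)).
Qed.

(** On the realization the round trip is [psi (l *: phi a)] by [rho_s], which [push_homotopy]
    contracts to the identity; the round trip on [M] is left to each model. *)
Lemma homotopy_equivalent_model :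
  homotopic_maps R M M (fun y : 'rV[R]_n => s (phi (psi (rho y)))) id ->
  homotopy_equivalent R (Y : set {ptws T -> R}) M.
Proof.
move=> sMM; exists (fun a => s (phi a)), (fun y : 'rV[R]_n => psi (rho y)); split=> //.
- split=> [|a aY]; last exact/s_M/phi_cone.
  apply: continuous_within_at => a aY.
  exact: (cvg_comp _ s (@phi_continuous_at a) (s_continuous (phi_cone aY))).
- split=> [|y yM]; last exact/psi_in_realization/rho_cone.
  by apply: continuous_within_at => y yM; exact: psi_rho_continuous.
have [|a aY|H [Hc HY H0 H1]] := @push_homotopy (fun a => l (phi a)).
- by move=> a aY; exact/l_gt0/phi_cone.
- exact: (cvg_comp _ l (@phi_continuous_at a) (l_continuous (phi_cone aY))).
exists H; split=> // a aY; rewrite H0 //= rho_s //; exact: phi_cone.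
Qed.

(** The segment from [phi (psi (rho y))] to [rho y] stays in the cone, and [s] carries it to a path
    in [M] ending at [y]. This serves the sphere. *)
Lemma homotopy_equivalent_section_model :
  (forall y : 'rV[R]_n, M y -> s (rho y) = y) -> homotopy_equivalent R (Y : set {ptws T -> R}) M.
Proof.
move=> s_rho; apply: homotopy_equivalent_model.
pose h (p : R * 'rV[R]_n) := (1 - p.1) *: phi (psi (rho p.2)) + p.1 *: rho p.2.
exists (fun p => s (h p)); split.
- apply: continuous_within_at => -[t y] [/= t01 yM].
  have hc : cone (h (t, y)).
    by apply: phi_psi_segment_cone; [exact: rho_cone|rewrite /= in_itv in t01].
  suff hcont : {for (t, y), continuous h} by exact: (cvg_comp _ s hcont (s_continuous hc)).
  have fc : {for (t, y), continuous (@fst R 'rV[R]_n)} by exact: cvg_fst.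
  have sc : {for (t, y), continuous (@snd R 'rV[R]_n)} by exact: cvg_snd.
  have pc : {for (t, y), continuous (fun p : R * 'rV[R]_n => phi (psi (rho p.2)))}.
    exact: (cvg_comp _ (fun v => phi (psi (rho v))) sc (phi_psi_rho_continuous yM)).
  have rc : {for (t, y), continuous (fun p : R * 'rV[R]_n => rho p.2)}.
    exact: (cvg_comp _ rho sc (rho_continuous yM)).
  apply: mx_continuous => i.
  rewrite (_ : (fun p => _) = fun p : R * 'rV[R]_n =>
      (1 - p.1) * phi (psi (rho p.2)) 0 i + p.1 * rho p.2 0 i); last first.
    by apply/funext => p; rewrite /h lin_combE.
  apply: (@continuousD _ R^o); apply: continuousM => //; last exact: coord_continuous_at.
    by apply: (@continuousB _ R^o) => //; exact: cst_continuous.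
  exact: coord_continuous_at.
- move=> t y t01 yM; apply/s_M/phi_psi_segment_cone => //; exact: rho_cone.
- by move=> y yM; rewrite /h /= subr0 scale1r scale0r addr0.
by move=> y yM; rewrite /h /= subrr scale1r scale0r add0r s_rho.
Qed.

(** Straight segments in [M] give the homotopy. This serves the ball, where [s] reaches only a
    simplex and so cannot invert [rho]. *)
Lemma homotopy_equivalent_convex_model :
  (forall (x y : 'rV[R]_n) t, M x -> M y -> 0 <= t <= 1 -> M ((1 - t) *: x + t *: y)) ->
  homotopy_equivalent R (Y : set {ptws T -> R}) M.
Proof.
move=> M_convex; apply: homotopy_equivalent_model.
pose f (y : 'rV[R]_n) := s (phi (psi (rho y))).
have fM (y : 'rV[R]_n) : M y -> M (f y) by move=> yM; apply/s_M/phi_cone/psi_in_realization/rho_cone.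
exists (fun p : R * 'rV[R]_n => (1 - p.1) *: f p.2 + p.1 *: p.2); split.
- apply: continuous_within_at => -[t y] [/= _ yM].
  have fc : {for (t, y), continuous (@fst R 'rV[R]_n)} by exact: cvg_fst.
  have sc : {for (t, y), continuous (@snd R 'rV[R]_n)} by exact: cvg_snd.
  have fcont : {for y, continuous f}.
    apply: (cvg_comp _ s (phi_psi_rho_continuous yM)).
    exact/s_continuous/phi_cone/psi_in_realization/rho_cone.
  have pc : {for (t, y), continuous (fun p : R * 'rV[R]_n => f p.2)}.
    exact: (cvg_comp _ f sc fcont).
  apply: mx_continuous => i.
  rewrite (_ : (fun p => _) = fun p : R * 'rV[R]_n =>
      (1 - p.1) * f p.2 0 i + p.1 * p.2 0 i); last first.
    by apply/funext => p; rewrite lin_combE.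
  apply: (@continuousD _ R^o); apply: continuousM => //; last exact: coord_continuous_at.
    by apply: (@continuousB _ R^o) => //; exact: cst_continuous.
  exact: coord_continuous_at.
- by move=> t y t01 yM; apply: M_convex => //; exact: fM.
- by move=> y yM; rewrite /= subr0 scale1r scale0r addr0.
by move=> y yM; rewrite /= subrr scale1r scale0r add0r.
Qed.

End Model.
End SubsetCarrier.

(** * Models of the ball and of the sphere *)

Section BallModel.
Variables (R : realType) (k : nat).
Implicit Types b y : 'rV[R]_k.

Definition nonempty_set : pred {set 'I_k} := fun S => S != finset.set0.

Definition ball_proj b : 'rV[R]_k := (\sum_i b 0 i)^-1 *: b.

(** Positive parts alone could all vanish; the second term then keeps the vector nonzero. It is zero
    on the standard simplex, the image of [ball_proj]. *)
Definition ball_lift y : 'rV[R]_k :=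
  \row_i (Num.max 0 (y 0 i) + Num.max 0 (1 - \sum_j Num.max 0 (y 0 j))).

Lemma cone_sum_gt0 b : cone nonempty_set b -> 0 < \sum_i b 0 i.
Proof.
move=> [b0 /finset.set0Pn[i]]; rewrite inE => bi.
by rewrite (bigD1 i) //= ltr_pwDl // sumr_ge0.
Qed.

Lemma sum_continuous b : {for b, continuous (fun b => \sum_i b 0 i)}.
Proof. by apply: continuous_sum_at => i; exact: coord_continuous. Qed.

Lemma inv_sum_continuous b : cone nonempty_set b ->
  {for b, continuous (fun b => (\sum_i b 0 i)^-1)}.
Proof.
move=> bc; apply: continuousV; last exact: sum_continuous.
by rewrite gt_eqF // cone_sum_gt0.
Qed.

Lemma ball_proj_continuous b : cone nonempty_set b -> {for b, continuous ball_proj}.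
Proof.
move=> bc; apply: mx_continuous => i.
rewrite (_ : (fun _ => _) = fun b => (\sum_i b 0 i)^-1 * b 0 i); last first.
  by apply/funext => v; rewrite mxE.
by apply: continuousM; [exact: inv_sum_continuous|exact: coord_continuous].
Qed.

Lemma ball_proj_ball b : cone nonempty_set b -> unit_ball (ball_proj b).
Proof.
move=> bc; have [b0 _] := bc; have t0 := cone_sum_gt0 bc.
have p0 i : 0 <= ball_proj b 0 i by rewrite mxE mulr_ge0 // invr_ge0 ltW.
have p1 : \sum_i ball_proj b 0 i = 1.
  under eq_bigr do rewrite mxE.
  by rewrite -mulr_sumr mulVf // gt_eqF.
rewrite /unit_ball /= /dot -[leRHS]p1; apply: ler_sum => i _.
rewrite ler_piMr // -p1 (bigD1 i) //= lerDl; exact: sumr_ge0.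
Qed.

Lemma ball_lift_continuous y : {for y, continuous ball_lift}.
Proof.
have mc (i : 'I_k) : {for y, continuous (fun v : 'rV[R]_k => Num.max 0 (v 0 i))}.
  by apply: continuous_max; [exact: cst_continuous|exact: coord_continuous].
apply: mx_continuous => i.
rewrite (_ : (fun _ => _) = fun y : 'rV[R]_k =>
   Num.max 0 (y 0 i) + Num.max 0 (1 - \sum_j Num.max 0 (y 0 j))); last first.
  by apply/funext => v; rewrite mxE.
apply: (@continuousD _ R^o); first exact: mc.
apply: continuous_max; first exact: cst_continuous.
by apply: (@continuousB _ R^o); [exact: cst_continuous|exact: continuous_sum_at].
Qed.

Lemma ball_lift_cone y (i0 : 'I_k) : cone nonempty_set (ball_lift y).
Proof.
have m0 (s : R) : 0 <= Num.max 0 s by rewrite le_max lexx.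
split=> [i|]; first by rewrite mxE addr_ge0.
apply/finset.set0Pn; apply: contrapT => none.
have l0 i : ball_lift y 0 i = 0.
  apply/eqP; rewrite eq_le; apply/andP; split; last by rewrite mxE addr_ge0.
  by rewrite leNgt; apply/negP => ypos; apply: none; exists i; rewrite inE.
have y0 i : Num.max 0 (y 0 i) = 0.
  by have /eqP := l0 i; rewrite mxE paddr_eq0 // => /andP[/eqP].
have := l0 i0; rewrite mxE big1 // y0 add0r subr0 max_r //; apply/eqP; exact: oner_neq0.
Qed.

Lemma ball_lift_proj b : cone nonempty_set b ->
  ball_lift (ball_proj b) = (\sum_i b 0 i)^-1 *: b.
Proof.
move=> bc; have [b0 _] := bc; have t0 := cone_sum_gt0 bc.
have mp i : Num.max 0 (ball_proj b 0 i) = ball_proj b 0 i.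
  by rewrite max_r // mxE mulr_ge0 // invr_ge0 ltW.
have p1 : \sum_i ball_proj b 0 i = 1.
  under eq_bigr do rewrite mxE.
  by rewrite -mulr_sumr mulVf // gt_eqF.
apply/rowP => i; rewrite mxE mp (eq_bigr (fun j => ball_proj b 0 j)) ?p1 //.
by rewrite subrr maxxx addr0.
Qed.

Lemma unit_ball_convex (x y : 'rV[R]_k) (t : R) : unit_ball x -> unit_ball y ->
  0 <= t <= 1 -> unit_ball ((1 - t) *: x + t *: y).
Proof.
rewrite /unit_ball /= => x1 y1 /andP[t0 t1].
apply: (@le_trans _ _ ((1 - t) * dot x x + t * dot y y)); last first.
  have := ler_wpM2l t0 y1; have : (1 - t) * dot x x <= (1 - t) * 1.
    by rewrite ler_wpM2l // subr_ge0.
  by rewrite !mulr1; lra.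
rewrite /dot !mulr_sumr -big_split /=; apply: ler_sum => i _; rewrite !lin_combE.
set p := x 0 i; set q := y 0 i; rewrite -subr_ge0.
rewrite [X in 0 <= X](_ : _ = t * (1 - t) * (p - q) ^+ 2); last by ring.
by apply: mulr_ge0 (sqr_ge0 _); rewrite mulr_ge0 // subr_ge0.
Qed.

End BallModel.

Section SphereModel.
Variables (R : realType) (n : nat).
Implicit Types (b : 'rV[R]_n.+1) (y : 'rV[R]_n).

Definition proper_nonempty_set : pred {set 'I_n.+1} :=
  fun S => (S != finset.set0) && (S != [set: 'I_n.+1]%SET).

(** Coordinates on the quotient by constant vectors. A nonzero class has exactly one nonnegative
    representative with a zero entry, and these representatives form the cone over the boundary of
    the simplex. *)
Definition sphere_diff b : 'rV[R]_n := \row_i (b 0 (lift ord0 i) - b 0 ord0).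

Definition sphere_proj b : 'rV[R]_n :=
  (Num.sqrt (dot (sphere_diff b) (sphere_diff b)))^-1 *: sphere_diff b.

Definition extend0 y : 'rV[R]_n.+1 :=
  \row_i (if unlift ord0 i is Some j then y 0 j else 0).

(** Shifts the class of [y] so that its least entry is 0. The default 0 of the minimum is harmless,
    being the entry at [ord0]. *)
Definition sphere_lift y : 'rV[R]_n.+1 :=
  \row_i (extend0 y 0 i - \big[Num.min/0]_(j < n.+1) extend0 y 0 j).

Lemma sphere_diff_neq0 b : cone proper_nonempty_set b -> sphere_diff b != 0.
Proof.
move=> [b0 /andP[/finset.set0Pn[i ip] pT]]; apply: contra_neq pT => d0.
have eqb j : b 0 j = b 0 ord0.
  case: (unliftP ord0 j) => [l ->|-> //]; apply/eqP; rewrite -subr_eq0; apply/eqP.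
  by have /rowP/(_ l) := d0; rewrite !mxE.
apply/setP => j; rewrite !inE eqb; move: ip; by rewrite inE eqb.
Qed.

Lemma sphere_norm_gt0 b : cone proper_nonempty_set b ->
  0 < Num.sqrt (dot (sphere_diff b) (sphere_diff b)).
Proof.
by move=> /sphere_diff_neq0 d0; rewrite sqrtr_gt0 lt_def dotxx_ge0 dotxx_eq0 d0.
Qed.

Lemma sphere_norm_continuous b : cone proper_nonempty_set b ->
  {for b, continuous (fun b => (Num.sqrt (dot (sphere_diff b) (sphere_diff b)))^-1)}.
Proof.
move=> bc; apply: continuousV; first by rewrite gt_eqF // sphere_norm_gt0.
have dc : {for b, continuous (fun b => dot (sphere_diff b) (sphere_diff b))}.
  apply: continuous_sum_at => i.
  rewrite (_ : (fun _ => _) = fun b : 'rV[R]_n.+1 => (b 0 (lift ord0 i) - b 0 ord0) *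
    (b 0 (lift ord0 i) - b 0 ord0)); last by apply/funext => v; rewrite !mxE.
  have c : {for b, continuous (fun b : 'rV[R]_n.+1 => b 0 (lift ord0 i) - b 0 ord0)}.
    by apply: (@continuousB _ R^o); exact: coord_continuous.
  exact: continuousM.
exact: (cvg_comp _ Num.sqrt dc (@sqrt_continuous R _)).
Qed.

Lemma sphere_proj_continuous b : cone proper_nonempty_set b ->
  {for b, continuous sphere_proj}.
Proof.
move=> bc; apply: mx_continuous => i.
rewrite (_ : (fun _ => _) = fun b =>
    (Num.sqrt (dot (sphere_diff b) (sphere_diff b)))^-1 *
    (b 0 (lift ord0 i) - b 0 ord0)); last by apply/funext => v; rewrite !mxE.
apply: continuousM; first exact: sphere_norm_continuous.
by apply: (@continuousB _ R^o); exact: coord_continuous.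
Qed.

Lemma sphere_proj_sphere b : cone proper_nonempty_set b -> unit_sphere (sphere_proj b).
Proof.
move=> /sphere_diff_neq0 d0; rewrite /unit_sphere /= dotZl dotZr mulrA -invfM -expr2.
by rewrite sqr_sqrtr ?dotxx_ge0 // mulVf // dotxx_eq0.
Qed.

Lemma extend0_continuous y i : {for y, continuous (fun y => extend0 y 0 i)}.
Proof.
rewrite (_ : (fun _ => _) =
  fun y : 'rV[R]_n => if unlift ord0 i is Some j then y 0 j else 0); last first.
  by apply/funext => v; rewrite mxE.
case: (unlift ord0 i) => [j|]; [exact: coord_continuous|exact: cst_continuous].
Qed.

Lemma sphere_lift_continuous y : {for y, continuous sphere_lift}.
Proof.
apply: mx_continuous => i.
rewrite (_ : (fun _ => _) = fun y => extend0 y 0 i -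
  \big[Num.min/0]_(j < n.+1) extend0 y 0 j); last by apply/funext => v; rewrite mxE.
apply: (@continuousB _ R^o); first exact: extend0_continuous.
by apply: continuous_bigmin_at => j; exact: extend0_continuous.
Qed.

Lemma extend0_min y :
  exists i, \big[Num.min/0]_(j < n.+1) extend0 y 0 j = extend0 y 0 i.
Proof.
have e0 : extend0 y 0 ord0 = 0 by rewrite mxE unlift_none.
elim/big_ind : _ => [|s t [i ->] [j ->]|i _]; [by exists ord0| |by exists i].
by rewrite /Num.min; case: ifP => _; [exists i|exists j].
Qed.

Lemma sphere_diff_lift y : sphere_diff (sphere_lift y) = y.
Proof.
apply/rowP => i; rewrite !mxE unlift_none liftK; ring.
Qed.

Lemma sphere_lift_cone y : unit_sphere y -> cone proper_nonempty_set (sphere_lift y).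
Proof.
move=> y1.
have l0 i : 0 <= sphere_lift y 0 i.
  by rewrite mxE subr_ge0; exact: bigmin_le_cond.
have yn0 : y != 0 by rewrite -dotxx_eq0 y1 oner_neq0.
split=> //; apply/andP; split; last first.
  have [i imin] := extend0_min y.
  apply/eqP => /setP/(_ i); rewrite !inE mxE imin subrr ltxx //.
apply/finset.set0Pn; apply: contrapT => none.
have z i : sphere_lift y 0 i = 0.
  apply/eqP; rewrite eq_le l0 andbT leNgt; apply/negP => ip.
  by apply: none; exists i; rewrite inE.
case/eqP: yn0; rewrite -(sphere_diff_lift y); apply/rowP => i.
by rewrite mxE !z subrr mxE.
Qed.

Lemma sphere_proj_lift y : unit_sphere y -> sphere_proj (sphere_lift y) = y.
Proof.
by move=> y1; rewrite /sphere_proj sphere_diff_lift y1 sqrtr1 invr1 scale1r.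
Qed.

Lemma sphere_lift_proj b : cone proper_nonempty_set b -> sphere_lift (sphere_proj b) =
  (Num.sqrt (dot (sphere_diff b) (sphere_diff b)))^-1 *: b.
Proof.
move=> bc; have l0 := sphere_norm_gt0 bc; have [b0 /andP[_ bT]] := bc.
rewrite /sphere_proj; set l := (Num.sqrt _)^-1.
have lpos : 0 < l by rewrite invr_gt0.
have ext i : extend0 (l *: sphere_diff b) 0 i = l * (b 0 i - b 0 ord0).
  rewrite mxE; case: unliftP => [j ->|->]; first by rewrite !mxE.
  by rewrite subrr mulr0.
have [i0 bi0] : exists i, b 0 i = 0.
  apply: contrapT => none; case/eqP: bT; apply/setP => i; rewrite !inE lt_def b0 andbT.
  by apply/eqP => bi; apply: none; exists i.
(* The minimum is attained at [i0], where [b] vanishes because its support is proper. *)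
have mn : \big[Num.min/0]_(j < n.+1) extend0 (l *: sphere_diff b) 0 j = - (l * b 0 ord0).
  apply/eqP; rewrite eq_le; apply/andP; split.
    rewrite (_ : - _ = extend0 (l *: sphere_diff b) 0 i0); last by rewrite ext bi0; ring.
    exact: bigmin_le_cond.
  have [i ->] := extend0_min (l *: sphere_diff b).
  by rewrite ext mulrBr lerBDr addrC subrr mulr_ge0 // ltW.
by apply/rowP => i; rewrite [LHS]mxE mn ext [RHS]mxE; ring.
Qed.

End SphereModel.

Section BallOrSphere.
Variables (R : realType) (T : choiceType) (le : T -> T -> Prop) (r : seq T).
Hypothesis r_uniq : uniq r.
Hypothesis le_trans : forall x y w, le x y -> le y w -> le x w.
Hypothesis le_anti : forall x y, le x y -> le y x -> x = y.

Lemma order_complex_ball k (i0 : 'I_k) (A : T -> {set 'I_k}) (J : {set 'I_k} -> T) :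
  (forall x y, x \in r -> y \in r -> le x y -> A x \subset A y) ->
  (forall x, x \in r -> A x != finset.set0) ->
  (forall S : {set 'I_k}, S != finset.set0 -> J S \in r) ->
  (forall S S' : {set 'I_k}, S != finset.set0 -> S \subset S' -> le (J S) (J S')) ->
  (forall x, x \in r -> le (J (A x)) x) ->
  homotopy_ball_or_sphere R (realization R (order_complex le [set x | x \in r])).
Proof.
move=> A_mono A_ok J_r J_mono JA; exists k; left.
rewrite (_ : realization _ _ = in_realization le r); last first.
  by apply/predeqP => a; exact: realizationP.
have ok_neq0 (S : {set 'I_k}) : nonempty_set S -> S != finset.set0 by [].
have ok_sub (S S' : {set 'I_k}) :
  nonempty_set S -> S' != finset.set0 -> S' \subset S -> nonempty_set S' by [].
have ok_mono (S S' : {set 'I_k}) :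
  nonempty_set S -> nonempty_set S' -> S \subset S' -> le (J S) (J S').
  by move=> okS _; exact: J_mono.
apply: (@homotopy_equivalent_convex_model R T le r k A J (@nonempty_set k) r_uniq
  le_trans le_anti A_mono A_ok ok_neq0 ok_sub J_r ok_mono JA k (@unit_ball R k)
  (@ball_proj R k) (@ball_lift R k) (fun b => (\sum_i b 0 i)^-1)).
- exact: ball_proj_continuous.
- exact: ball_proj_ball.
- by move=> y _; exact: ball_lift_continuous.
- by move=> y _; exact: ball_lift_cone.
- exact: inv_sum_continuous.
- by move=> b bc; rewrite invr_gt0 cone_sum_gt0.
- exact: ball_lift_proj.
exact: unit_ball_convex.
Qed.

Lemma order_complex_sphere n (A : T -> {set 'I_n.+1}) (J : {set 'I_n.+1} -> T) :
  (forall x y, x \in r -> y \in r -> le x y -> A x \subset A y) ->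
  (forall x, x \in r -> proper_nonempty_set (A x)) ->
  (forall S : {set 'I_n.+1}, proper_nonempty_set S -> J S \in r) ->
  (forall S S' : {set 'I_n.+1}, S != finset.set0 -> S \subset S' -> le (J S) (J S')) ->
  (forall x, x \in r -> le (J (A x)) x) ->
  (forall S : {set 'I_n.+1}, proper_nonempty_set S -> A (J S) \subset S) ->
  homotopy_ball_or_sphere R (realization R (order_complex le [set x | x \in r])).
Proof.
move=> A_mono A_ok J_r J_mono JA AJ; exists n; right.
rewrite (_ : realization _ _ = in_realization le r); last first.
  by apply/predeqP => a; exact: realizationP.
have ok_neq0 (S : {set 'I_n.+1}) : proper_nonempty_set S -> S != finset.set0.
  by case/andP.
have ok_sub (S S' : {set 'I_n.+1}) :
  proper_nonempty_set S -> S' != finset.set0 -> S' \subset S -> proper_nonempty_set S'.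
  move=> /andP[S0 ST] S'0 S'S; rewrite /proper_nonempty_set S'0 /=.
  by apply: contra_neq ST => S'T; apply/eqP; rewrite -finset.subTset -S'T.
have ok_mono (S S' : {set 'I_n.+1}) :
  proper_nonempty_set S -> proper_nonempty_set S' -> S \subset S' -> le (J S) (J S').
  by move=> /andP[S0 _] _; exact: J_mono.
apply: (@homotopy_equivalent_section_model R T le r n.+1 A J (@proper_nonempty_set n) r_uniq
  le_trans le_anti A_mono A_ok ok_neq0 ok_sub J_r ok_mono JA AJ n (@unit_sphere R n)
  (@sphere_proj R n) (@sphere_lift R n)
  (fun b => (Num.sqrt (dot (sphere_diff b) (sphere_diff b)))^-1)).
- exact: sphere_proj_continuous.
- exact: sphere_proj_sphere.
- by move=> y _; exact: sphere_lift_continuous.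
- exact: sphere_lift_cone.
- exact: sphere_norm_continuous.
- by move=> b bc; rewrite invr_gt0 sphere_norm_gt0.
- exact: sphere_lift_proj.
exact: sphere_proj_lift.
Qed.

End BallOrSphere.

(** * Vertices and edges of a simple zonotope *)

Section Zonotope.
Variables (R : realType) (d : nat) (I : finType).
Local Notation V := 'rV[R]_d.
Variables (z : I -> V) (o c : V).
Implicit Types (u v w q x y : V) (s : R) (t : I -> R) (i j : I) (S : {set I}).

Definition zpoint t : V := o + \sum_i t i *: z i.

Definition zonotope : set V :=
  [set x | exists2 t, (forall i, 0 <= t i <= 1) & x = zpoint t].

Local Notation P := zonotope.

Definition top_vertex w : V := o + \sum_(i | 0 < dot w (z i)) z i.

Definition regular w : Prop := forall i, dot w (z i) != 0.

Lemma dot_zpoint w t : dot w (zpoint t) = dot w o + \sum_i t i * dot w (z i).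
Proof.
by rewrite dotDr dot_sumr; congr (_ + _); apply: eq_bigr => i _; rewrite dotZr.
Qed.

Lemma subset_sumE (A : {pred I}) :
  o + \sum_(i in A) z i = zpoint (fun i => (i \in A)%:R).
Proof.
congr (_ + _); rewrite big_mkcond; apply: eq_bigr => i _.
by case: (i \in A); rewrite ?scale1r ?scale0r.
Qed.

Lemma subset_sum_zonotope (A : {pred I}) : P (o + \sum_(i in A) z i).
Proof.
rewrite subset_sumE; exists (fun i => (i \in A)%:R) => // i.
by case: (i \in A); rewrite ?lexx ?ler01.
Qed.

Lemma top_vertexE w : top_vertex w = zpoint (fun i => (0 < dot w (z i))%R%:R).
Proof. exact: (subset_sumE [pred i | 0 < dot w (z i)]). Qed.

Lemma top_vertex_zonotope w : P (top_vertex w).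
Proof. exact: (subset_sum_zonotope [pred i | 0 < dot w (z i)]). Qed.

Lemma zonotope_update t i s : (forall j, 0 <= t j <= 1) -> 0 <= s <= 1 ->
  P (zpoint t + (s - t i) *: z i).
Proof.
move=> t01 s01; exists (fun j => if j == i then s else t j) => [j|].
  by case: ifP.
rewrite /zpoint -addrA; congr (_ + _); rewrite (bigD1 i) //= addrAC -scalerDl addrC.
rewrite [RHS](bigD1 i) //= eqxx addrC; congr (_ + _); first by congr (_ *: _); ring.
by apply: eq_bigr => j /negbTE ->.
Qed.

(** All summands are nonnegative on the zonotope, so maximality of [top_vertex w] and the
    coordinates of other maximizers are read off termwise. *)
Lemma zpoint_gap w t : dot w (top_vertex w) - dot w (zpoint t) =
  \sum_i ((0 < dot w (z i))%R%:R - t i) * dot w (z i).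
Proof.
rewrite top_vertexE !dot_zpoint opprD addrACA subrr add0r -sumrB.
by apply: eq_bigr => i _; rewrite mulrBl.
Qed.

Lemma zpoint_gap_ge0 w t i : 0 <= t i <= 1 ->
  0 <= ((0 < dot w (z i))%R%:R - t i) * dot w (z i).
Proof.
move=> /andP[t0 t1]; case: ltP => h.
  by rewrite mulr_ge0 ?subr_ge0 // ltW.
by rewrite sub0r mulr_le0 // oppr_le0.
Qed.

Lemma top_vertex_max w x : P x -> dot w x <= dot w (top_vertex w).
Proof.
move=> [t t01 ->]; rewrite -subr_ge0 zpoint_gap sumr_ge0 // => i _.
exact: zpoint_gap_ge0.
Qed.

Lemma top_vertex_coord w t i : (forall j, 0 <= t j <= 1) ->
  dot w (zpoint t) = dot w (top_vertex w) ->
  dot w (z i) != 0 -> t i = (0 < dot w (z i))%R%:R.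
Proof.
move=> t01 /eqP; rewrite eq_sym -subr_eq0 zpoint_gap psumr_eq0; last first.
  by move=> j _; exact: zpoint_gap_ge0.
move=> /allP/(_ i (mem_index_enum _)) /=; rewrite mulf_eq0 subr_eq0.
by case/orP => /eqP -> //; rewrite eqxx.
Qed.

Lemma top_vertex_unique w x : regular w -> P x ->
  dot w x = dot w (top_vertex w) -> x = top_vertex w.
Proof.
move=> wreg [t t01 ->] wt.
have tE i := top_vertex_coord t01 wt (wreg i).
rewrite top_vertexE /zpoint; congr (_ + _); apply: eq_bigr => i _.
by rewrite tE.
Qed.

Lemma regular_vertex w : regular w -> is_vertex P (top_vertex w).
Proof.
move=> wreg; split; last first.
  split; first by exists (top_vertex w).
  exists 0%VS; split; first exact: dimv0.
    by move=> x y /= -> ->; rewrite subrr mem0v.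
  by move=> W _; exact: sub0v.
exists w, (dot w (top_vertex w)); split; first exact: top_vertex_max.
apply/seteqP; split=> [x /= ->|x /= [xP xw]]; last exact: top_vertex_unique.
by split=> //; exact: top_vertex_zonotope.
Qed.

Hypothesis z_neq0 : forall i, z i != 0.

(** If the exposing functional vanished on [z i], coordinate [i] could be set to 0 or to 1 within
    the face, which is a single point. *)
Lemma vertex_regular v : is_vertex P v -> exists2 w, regular w & v = top_vertex w.
Proof.
move=> [[w [m [wm vE]]] _].
have [vP vm] : P v /\ dot w v = m by have : [set v] v by []; rewrite {1}vE.
have face x : P x -> dot w x = m -> x = v.
  by move=> xP xm; suff : [set v] x by []; rewrite vE.
have [t t01 vt] := vP.
have wreg : regular w.
  move=> i; apply: contraT => /negPn/eqP wi.
  have fixed s : 0 <= s <= 1 -> s = t i.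
    move=> s01; have : v + (s - t i) *: z i = v.
      apply: face; first by rewrite vt; exact: zonotope_update.
      by rewrite dotDr dotZr wi mulr0 addr0.
    move=> /(canRL (addKr _)); rewrite addNr => /eqP.
    by rewrite scaler_eq0 (negbTE (z_neq0 i)) orbF subr_eq0 => /eqP.
  have t_0 : 0 = t i by apply: fixed; rewrite lexx ler01.
  have t_1 : 1 = t i by apply: fixed; rewrite lexx ler01.
  by have /eqP := t_1; rewrite -t_0 oner_eq0.
exists w => //; apply: top_vertex_unique => //; apply/eqP; rewrite eq_le.
rewrite top_vertex_max // vm wm //; exact: top_vertex_zonotope.
Qed.

Lemma vertex_zonotope v : is_vertex P v -> P v.
Proof. by move=> /vertex_regular[w _ ->]; exact: top_vertex_zonotope. Qed.

(** Formulated through [P], hence independent of the functional that exposes [v]; for a regular [w]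
    it is the set of generators on which [w] is positive. *)
Definition inv v : {set I} := finset (fun i => `[< P (v - z i) >]).

Lemma inv_zonotope v i : i \in inv v -> P (v - z i).
Proof. by rewrite inE => /asboolP. Qed.

Lemma inv_top_vertex w i : regular w -> (i \in inv (top_vertex w)) = (0 < dot w (z i)).
Proof.
move=> wreg; rewrite inE; apply/asboolP/idP => [vP|wi].
  have := top_vertex_max w vP.
  by rewrite dotBr lerBlDr lerDl le_eqVlt eq_sym (negbTE (wreg i)).
rewrite top_vertexE.
suff -> : zpoint (fun j => (0 < dot w (z j))%R%:R) - z i =
    zpoint (fun j => (0 < dot w (z j))%R%:R) + (0 - (0 < dot w (z i))%R%:R) *: z i.
  by apply: zonotope_update => [j|]; rewrite ?lexx ?ler01 //; case: (0 < _); rewrite ?lexx ?ler01.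
by rewrite wi sub0r scaleN1r.
Qed.

Lemma notin_inv_zonotope v i : is_vertex P v -> i \notin inv v -> P (v + z i).
Proof.
move=> /vertex_regular[w wreg ->]; rewrite inv_top_vertex // => wi.
rewrite top_vertexE.
suff -> : zpoint (fun j => (0 < dot w (z j))%R%:R) + z i =
    zpoint (fun j => (0 < dot w (z j))%R%:R) + (1 - (0 < dot w (z i))%R%:R) *: z i.
  by apply: zonotope_update => [j|]; rewrite ?lexx ?ler01 //; case: (0 < _); rewrite ?lexx ?ler01.
by rewrite (negbTE wi) subr0 scale1r.
Qed.

Lemma vertex_inv v : is_vertex P v -> v = o + \sum_(i in inv v) z i.
Proof.
move=> /vertex_regular[w wreg ->]; rewrite {1}/top_vertex; congr (_ + _).
by apply: eq_bigl => i; rewrite inv_top_vertex.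
Qed.

Lemma inv_inj u v : is_vertex P u -> is_vertex P v -> inv u = inv v -> u = v.
Proof. by move=> uV vV uv; rewrite (vertex_inv uV) (vertex_inv vV) uv. Qed.

Lemma vertexB u v : is_vertex P u -> is_vertex P v -> inv u \subset inv v ->
  v - u = \sum_(i in inv v :\: inv u) z i.
Proof.
move=> uV vV uv; rewrite {1}(vertex_inv uV) {1}(vertex_inv vV).
rewrite opprD addrACA subrr add0r (finset.big_setID (inv u)) /= (finset.setIidPr uv).
by rewrite addrC addKr.
Qed.

Hypothesis c_gt0 : forall i, 0 < dot c (z i).

(** If [i] were used at [u] but not at [v], then [u - z i] and [v + z i] in [P] would force the edge
    to be parallel to [z i]. The multiple of [z i] leading from [u] to [v] would be positive because
    [c] increases, yet nonpositive because a functional positive on [z i] is maximal at [u]. *)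
Lemma G_arc_inv u v : G_arc P c u v -> inv u \subset inv v.
Proof.
move=> [uV vV [e [[q [m [qm eE]]] [_ [U [dimU eU _]]]] [eu ev]] cuv].
apply/fintype.subsetP => i iu; apply: contraT => iv.
have [_ um] : P u /\ dot q u = m by move: eu; rewrite eE.
have [_ vm] : P v /\ dot q v = m by move: ev; rewrite eE.
have uzP := inv_zonotope iu.
have qi : dot q (z i) = 0.
  apply/eqP; rewrite eq_le; apply/andP; split.
    by have := qm _ (notin_inv_zonotope vV iv); rewrite dotDr vm gerDl.
  by have := qm _ uzP; rewrite dotBr um lerBlDr lerDl.
have uze : e (u - z i) by rewrite eE; split=> //; rewrite dotBr qi subr0.
have ziU : z i \in U by have := eU _ _ eu uze; rewrite subKr.
have UE : (U <= <[z i]>)%VS.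
  by rewrite -(geq_leqif (dimv_leqif_sup _)) ?dimU ?dim_vline ?z_neq0 // -memvE.
have /vlineP[s vuE] : v - u \in <[z i]>%VS by apply: (subvP UE); exact: eU.
have [w wreg uE] := vertex_regular uV.
have wi : 0 < dot w (z i) by rewrite -(inv_top_vertex _ wreg) -uE.
have : dot w (v - u) <= 0.
  by rewrite dotBr subr_le0 uE top_vertex_max //; exact: vertex_zonotope.
have : 0 < dot c (v - u) by rewrite dotBr subr_gt0.
rewrite vuE !dotZr pmulr_lgt0 // pmulr_lle0 // => h1 h2.
by have := lt_le_trans h1 h2; rewrite ltxx.
Qed.

Lemma G_le_inv u v : G_le P c u v ->
  [/\ is_vertex P u, is_vertex P v & inv u \subset inv v].
Proof.
move=> [uV [s]]; elim: s u uV => [|x s IHs] u uV /=; first by move=> _ <-.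
move=> /andP[/asboolP ux xs] xv; have [_ xV _ _] := ux.
have [_ vV xvI] := IHs x xV xs xv; split=> //.
exact: fintype.subset_trans (G_arc_inv ux) xvI.
Qed.

(** * Edges and faces at a fixed vertex *)

Section EdgesAtVertex.
Variable w : V.
Hypothesis w_regular : regular w.
Local Notation u := (top_vertex w).

Definition ray i : V := if 0 < dot w (z i) then - z i else z i.

Lemma ray_lt0 i : dot w (ray i) < 0.
Proof.
rewrite /ray; case: ifPn => [wi|]; first by rewrite dotNr oppr_lt0.
by rewrite -leNgt lt_neqAle w_regular.
Qed.

Lemma ray_inv i : ray i = if i \in inv u then - z i else z i.
Proof. by rewrite inv_top_vertex. Qed.

Lemma zonotope_rays x : P x -> exists2 l : I -> R, (forall i, 0 <= l i) &
  x - u = \sum_i l i *: ray i.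
Proof.
move=> [t t01 ->]; exists (fun i => if 0 < dot w (z i) then 1 - t i else t i).
  by move=> i; have /andP[t0 t1] := t01 i; case: ifP => // _; rewrite subr_ge0.
rewrite top_vertexE /zpoint opprD addrACA subrr add0r -sumrB.
apply: eq_bigr => i _; rewrite -scalerBl /ray; case: ifP => _ /=; last by rewrite subr0.
by rewrite scalerN -scaleNr opprB.
Qed.

Lemma add_ray_zonotope i : P (u + ray i).
Proof.
have uV := regular_vertex w_regular.
rewrite ray_inv; case: ifPn => h; first exact: inv_zonotope.
exact: notin_inv_zonotope.
Qed.

Variable B : {set I}.
Hypothesis B_gen : forall i, cone_over ray B (ray i).

Lemma dot_rays_le0 q : (forall i, i \in B -> dot q (ray i) <= 0) ->
  forall j, dot q (ray j) <= 0.
Proof.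
move=> qB j; have [l l0 ->] := B_gen j; rewrite dot_sumr; apply: sumr_le0 => m mB.
by rewrite dotZr mulr_ge0_le0 // qB.
Qed.

Lemma dot_zonotope_le q : (forall i, i \in B -> dot q (ray i) <= 0) ->
  forall x, P x -> dot q x <= dot q u.
Proof.
move=> qB x /zonotope_rays[l l0 xu]; rewrite -subr_le0 -dotBr xu dot_sumr.
by apply: sumr_le0 => i _; rewrite dotZr mulr_ge0_le0 // dot_rays_le0.
Qed.

(** A sum of nonpositive terms equal to zero has only zero terms, so generators on which [q] is
    negative have coefficient 0. *)
Lemma exposed_cone q j : (forall i, i \in B -> dot q (ray i) <= 0) ->
  dot q (ray j) = 0 ->
  cone_over ray (finset (fun i => (i \in B) && (dot q (ray i) == 0))) (ray j).
Proof.
move=> qB; have [l l0 jE] := B_gen j; rewrite jE dot_sumr => /eqP.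
rewrite -oppr_eq0 -sumrN psumr_eq0; last first.
  by move=> m mB; rewrite oppr_ge0 dotZr mulr_ge0_le0 // qB.
move=> /allP ql; exists l => //.
rewrite (bigID (fun i => dot q (ray i) == 0)) /= [X in _ + X]big1 ?addr0.
  by apply: eq_bigl => m; rewrite inE.
move=> m /andP[mB qm]; have := ql m (mem_index_enum _).
by rewrite mB /= dotZr oppr_eq0 mulf_eq0 (negbTE qm) orbF => /eqP ->; rewrite scale0r.
Qed.

Lemma edge_of_ray q i : i \in B -> dot q (ray i) = 0 ->
  (forall j, j \in B -> j != i -> dot q (ray j) < 0) ->
  is_edge P [set x | P x /\ dot q x = dot q u].
Proof.
move=> iB qi qB.
have qB' j : j \in B -> dot q (ray j) <= 0.
  by move=> jB; have [->|ji] := eqVneq j i; [rewrite qi|exact/ltW/qB].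
have uP := top_vertex_zonotope w.
have on_line j : dot q (ray j) = 0 -> ray j \in <[ray i]>%VS.
  move=> /(exposed_cone qB')[l l0 ->]; apply: memv_suml => m; rewrite inE => /andP[mB qm].
  rewrite memvZ //; have [->|mi] := eqVneq m i; first exact: memv_line.
  by have := qB m mB mi; rewrite (eqP qm) ltxx.
have face x : P x -> dot q x = dot q u -> x - u \in <[ray i]>%VS.
  move=> xP qx; have [l l0 xu] := zonotope_rays xP.
  have /eqP : dot q (x - u) = 0 by rewrite dotBr qx subrr.
  rewrite xu dot_sumr -oppr_eq0 -sumrN psumr_eq0; last first.
    by move=> m _; rewrite oppr_ge0 dotZr mulr_ge0_le0 // dot_rays_le0.
  move=> /allP ql; apply: memv_suml => m _.
  have := ql m (mem_index_enum _); rewrite /= oppr_eq0 dotZr mulf_eq0.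
  by case/orP => /eqP h; [rewrite h scale0r mem0v|rewrite memvZ // on_line].
have ri0 : ray i != 0 by apply: contraTneq (ray_lt0 i) => ->; rewrite dot0r ltxx.
split; first by exists q, (dot q u); split=> //; exact: dot_zonotope_le.
split; first by exists u.
exists <[ray i]>%VS; split; first by rewrite dim_vline ri0.
  move=> x y [xP qx] [yP qy].
  rewrite (_ : x - y = (x - u) - (y - u)); last by rewrite opprB addrA subrK.
  by apply: memvB; exact: face.
move=> W WP; rewrite -memvE (_ : ray i = (u + ray i) - u); last by rewrite addrC addKr.
by apply: WP; split=> //; [exact: add_ray_zonotope|rewrite dotDr qi addr0].
Qed.

Hypothesis B_extreme : forall i, i \in B -> exists2 q, dot q (ray i) = 0 &
  forall j, j \in B -> j != i -> dot q (ray j) < 0.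

(* Applied to all edges at [u], simplicity produces a face whose dimension is
   the number of these edges, while their directions span the whole of [P]. *)
Lemma simple_dim_rays : is_simple P -> (#|B| <= \dim <<[seq ray i | i <- enum B]>>)%N.
Proof.
move=> simpleP.
have /choice[q qP] : forall i, exists q, i \in B -> dot q (ray i) = 0 /\
    forall j, j \in B -> j != i -> dot q (ray j) < 0.
  move=> i; have [/B_extreme[q qi qB]|_] := boolP (i \in B); first by exists q.
  by exists 0.
have uP := top_vertex_zonotope w.
pose e i : set V := [set x | P x /\ dot (q i) x = dot (q i) u].
(* Numbers the edges, to match the cardinality condition in [is_simple]; the default is never met
   below [#|B|]. *)
pose f n : set V := if insub n is Some l then e (@enum_val I (mem B) l) else set0.
have f_inj : {in `I_#|B| &, injective f}.
  move=> m n; rewrite !inE /= => mB nB; rewrite /f !insubT /= => emn.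
  set i := enum_val _ in emn; set j := enum_val _ in emn.
  have [iB jB] : i \in B /\ j \in B by split; exact: enum_valP.
  have : e i (u + ray i).
    (* The point [u + ray i] separates the edges: [q j] is negative on [ray i] when [j] differs from
       [i]. *)
    by split; [exact: add_ray_zonotope|rewrite dotDr (qP i iB).1 addr0].
  rewrite emn => -[_]; rewrite dotDr => /(canRL (addKr _)); rewrite addNr => qji.
  have [ij|ij] := eqVneq i j; last first.
    by have := (qP j jB).2 i iB ij; rewrite qji ltxx.
  by have := enum_val_inj ij => /(congr1 val).
have [|F [[[qF [mF [_ FE]]] [_ [U [<- _ Umin]]]] _ _]] :=
    simpleP u (regular_vertex w_regular) #|B| (f @` `I_#|B|) (inj_card_eq f_inj).
  move=> _ [n nB <-]; rewrite /f insubT /=; set i := enum_val _.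
  have iB : i \in B by exact: enum_valP.
  by split; [exact: edge_of_ray (qP i iB).1 (qP i iB).2|split].
apply/dimvS/Umin.
have span x : P x -> x - u \in <<[seq ray i | i <- enum B]>>%VS.
  move=> /zonotope_rays[l _ ->]; apply: memv_suml => j _; apply: memvZ.
  have [k _ ->] := B_gen j; apply: memv_suml => i iB; apply/memvZ/memv_span.
  by apply: map_f; rewrite mem_enum.
move=> x y; rewrite FE => -[xP _] [yP _].
rewrite (_ : x - y = (x - u) - (y - u)); last by rewrite opprB addrA subrK.
by apply: memvB; exact: span.
Qed.

Lemma ray_up i : i \notin inv u -> ray i = z i.
Proof. by rewrite ray_inv => /negbTE ->. Qed.

(** The cost is nonnegative on a cone of upward rays and negative on the ray of a generator used at
    [u]. *)
Lemma cone_up_notin_inv S j : (forall i, i \in S -> i \notin inv u) ->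
  cone_over ray S (ray j) -> j \notin inv u.
Proof.
move=> Su [l l0 jE]; apply/negP => ju.
have : 0 <= dot c (ray j).
  rewrite jE dot_sumr; apply: sumr_ge0 => i iS.
  by rewrite dotZr mulr_ge0 // ray_up ?Su // ltW.
by rewrite ray_inv ju dotNr oppr_ge0 leNgt c_gt0.
Qed.

(* The top of the face spanned by the upward edges in [S]. *)
Lemma face_top S : is_simple P -> S \subset B -> (forall i, i \in S -> i \notin inv u) ->
  exists y, [/\ is_vertex P y, inv u \subset inv y,
    forall i, i \in B -> i \notin inv u -> (i \in inv y) = (i \in S),
    forall x, is_vertex P x -> inv u \subset inv x -> S \subset inv x ->
      inv y \subset inv x &
    forall i, S = [set i]%SET -> G_arc P c u y].
Proof.
move=> simpleP SB Su.
have [q qB] := free_dual (fun i => if i \in S then 0 else -1) (simple_dim_rays simpleP).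
have [M HM] := lex_perturbation z q (- w).
have q_le0 i : i \in B -> dot q (ray i) <= 0.
  by move=> iB; rewrite qB //; case: ifP; rewrite ?oppr_le0.
have qS j : dot q (ray j) = 0 -> cone_over ray S (ray j).
  move=> /(exposed_cone q_le0).
  rewrite (_ : finset _ = S) //; apply/setP => i; rewrite inE.
  have [iS|iS] := boolP (i \in S).
    by rewrite (fintype.subsetP SB) //= qB ?(fintype.subsetP SB) // iS eqxx.
  by case: (boolP (i \in B)) => //= iB; rewrite qB // (negbTE iS) oppr_eq0 oner_eq0.
(* Maximizes [q] first, then minimizes [w] on the resulting face: it selects the vertex opposite to
   [u] there. *)
pose w' := M *: q - w.
have w'0 j : dot q (z j) = 0 -> dot w' (z j) = - dot w (z j).
  by move=> qj; rewrite dotDl dotNl dotZl qj mulr0 add0r.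
have w'reg : regular w'.
  move=> j; have [qj|qj|qj] := ltgtP (dot q (z j)) 0.
  - by rewrite lt_eqF // (HM j).2.
  - by rewrite gt_eqF // (HM j).1.
  - by rewrite w'0 // oppr_eq0.
pose y := top_vertex w'.
have qz j : (dot q (ray j) == 0) = (dot q (z j) == 0).
  by rewrite /ray; case: ifP; rewrite ?dotNr ?oppr_eq0.
have invy j : j \notin inv u -> (j \in inv y) = (dot q (z j) == 0).
  move=> ju; have := dot_rays_le0 q_le0 j; rewrite ray_up // inv_top_vertex // => qj.
  have [q0|q0] := eqVneq (dot q (z j)) 0.
    by rewrite w'0 // oppr_gt0 lt_neqAle w_regular /= leNgt -(inv_top_vertex _ w_regular).
  by apply/negbTE; rewrite -leNgt ltW // (HM j).2 // lt_neqAle q0.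
(* A generator used at [u] is never flipped: if [q] vanished on it, its ray would lie in the cone of
   upward rays. *)
have yu : inv u \subset inv y.
  apply/fintype.subsetP => j ju; rewrite inv_top_vertex //.
  have := dot_rays_le0 q_le0 j; rewrite ray_inv ju dotNr oppr_le0 le_eqVlt.
  case/orP => [/eqP qj|]; last exact: (HM j).1.
  have /qS/(cone_up_notin_inv Su) : dot q (ray j) = 0.
    by apply/eqP; rewrite qz -qj.
  by rewrite ju.
have invyB i : i \in B -> i \notin inv u -> (i \in inv y) = (i \in S).
  move=> iB iu; rewrite invy // -qz qB //; case: ifP => _; first by rewrite eqxx.
  by rewrite oppr_eq0 oner_eq0.
have uV := regular_vertex w_regular; have yV := regular_vertex w'reg.
have yuE := vertexB uV yV yu.
exists y; split=> //.
  (* Each generator gained from [u] to [y] lies in the cone over [S], where the functional exposing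
     [x] is nonnegative; regularity makes it positive. *)
  move=> x xV ux Sx; apply/fintype.subsetP => j jy.
  have [/(fintype.subsetP ux) //|ju] := boolP (j \in inv u).
  have [w0 w0reg xE] := vertex_regular xV.
  move: jy; rewrite invy // -qz => /eqP/qS[l l0]; rewrite ray_up // => jE.
  rewrite xE inv_top_vertex // lt_neqAle eq_sym w0reg jE dot_sumr sumr_ge0 // => i iS.
  rewrite dotZr mulr_ge0 // ray_up ?Su // ltW //.
  by rewrite -(inv_top_vertex _ w0reg) -xE (fintype.subsetP Sx).
move=> i Si; have iS : i \in S by rewrite Si inE.
have iB := fintype.subsetP SB i iS; have iu := Su i iS.
split=> //; last first.
  rewrite -subr_gt0 -dotBr yuE dot_sumr (bigD1 i) /=; last by rewrite finset.in_setD iu invyB.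
  by rewrite ltr_pwDl // sumr_ge0 // => j _; rewrite ltW.
exists [set x | P x /\ dot q x = dot q u].
  apply: (@edge_of_ray q i) => [//| |j jB ji]; first by rewrite qB // iS.
  by rewrite qB // Si inE (negbTE ji) oppr_lt0.
split; first by split=> //; exact: top_vertex_zonotope.
split; first exact: top_vertex_zonotope.
apply/eqP; rewrite -subr_eq0 -dotBr yuE dot_sumr big1 // => j.
by rewrite finset.in_setD => /andP[ju]; rewrite invy // => /eqP.
Qed.

Lemma exists_upward_ray x : is_vertex P x -> inv u \subset inv x -> x <> u ->
  exists i, [/\ i \in B, i \notin inv u & i \in inv x].
Proof.
move=> xV ux xu; have uV := regular_vertex w_regular.
have [w0 w0reg xE] := vertex_regular xV.
have invx i : (i \in inv x) = (0 < dot w0 (z i)) by rewrite xE inv_top_vertex.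
have [j jx ju] : exists2 j, j \in inv x & j \notin inv u.
  apply/fintype.subsetPn; apply/negP => xsu; apply: xu; apply: inv_inj => //.
  by apply/eqP; rewrite finset.eqEsubset xsu.
have [l l0 jE] := B_gen j.
have : 0 < dot w0 (ray j) by rewrite ray_up // -invx.
rewrite jE dot_sumr => pos.
have [i iB wi] : exists2 i, i \in B & 0 < dot w0 (ray i).
  apply: contrapT => none; move: pos; apply/negP; rewrite -leNgt; apply: sumr_le0 => i iB.
  rewrite dotZr mulr_ge0_le0 // leNgt; apply/negP => wi; apply: none; by exists i.
have iu : i \notin inv u.
  apply/negP => iu; have := fintype.subsetP ux i iu; rewrite invx.
  by move: wi; rewrite ray_inv iu dotNr oppr_gt0 => /ltW; rewrite leNgt => /negP.
by exists i; split=> //; rewrite invx -(ray_up iu).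
Qed.

End EdgesAtVertex.

Lemma upward_edges u : is_simple P -> is_vertex P u -> exists B : {set I},
  [/\ forall i, i \in B -> i \notin inv u,
  forall x, is_vertex P x -> inv u \subset inv x -> x <> u ->
    exists2 i, i \in B & i \in inv x &
  forall S : {set I}, S \subset B -> exists y, [/\ is_vertex P y, inv u \subset inv y,
    forall i, i \in B -> (i \in inv y) = (i \in S),
    forall x, is_vertex P x -> inv u \subset inv x -> S \subset inv x ->
      inv y \subset inv x &
    forall i, S = [set i]%SET -> G_arc P c u y]].
Proof.
move=> simpleP /vertex_regular[w wreg ->].
have [B Bgen Bext] := extreme_rays (ray_lt0 wreg).
exists (B :\: inv (top_vertex w))%SET; split=> [i|x xV ux xu|S].
- by rewrite finset.in_setD => /andP[].
- have [i [iB iu ix]] := exists_upward_ray wreg Bgen xV ux xu.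
  by exists i; rewrite // finset.in_setD iu.
rewrite finset.subsetD finset.disjoints_subset => /andP[SB /fintype.subsetP Su].
have [|y [yV uy yB ymin yarc]] := face_top wreg Bgen Bext simpleP SB.
  by move=> i /Su; rewrite finset.in_setC.
by exists y; split=> // i; rewrite finset.in_setD => /andP[iu iB]; exact: yB.
Qed.

(** Induction on the number of generators missing at [u]. The endpoint of an edge with generator in
    [inv v] is below [v] by the minimality of face tops. *)
Lemma G_le_of_inv u v : is_simple P -> is_vertex P u -> is_vertex P v ->
  inv u \subset inv v -> G_le P c u v.
Proof.
move=> simpleP uV vV uv; split=> //.
have [n] := ubnP #|inv v :\: inv u|; elim: n u uV uv => // n IHn u uV uv vu.
have [->|/eqP vneu] := eqVneq v u; first by exists [::].
have [B [Bu Bup Btop]] := upward_edges simpleP uV.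
have [i iB iv] := Bup v vV uv vneu.
have [|y [yV uy yB ymin yarc]] := Btop [set i]%SET; first by rewrite finset.sub1set.
have uyarc := yarc i erefl.
have yv : inv y \subset inv v by apply: ymin; rewrite ?finset.sub1set.
have iy : i \in inv y by rewrite yB // inE.
have [|s ys sv] := IHn y yV yv.
  apply: leq_trans (_ : #|inv v :\: inv y| < #|inv v :\: inv u|)%N _; last first.
    by rewrite -ltnS.
  apply/proper_card/fintype.properP; split; first exact: finset.setDS.
  by exists i; rewrite !finset.in_setD iv ?iy ?Bu.
by exists (y :: s) => //=; rewrite ys andbT; apply/asboolP.
Qed.

Lemma G_leE u v : is_simple P ->
  G_le P c u v <-> [/\ is_vertex P u, is_vertex P v & inv u \subset inv v].
Proof.
move=> simpleP; split; first exact: G_le_inv.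
by case=> uV vV uv; exact: G_le_of_inv.
Qed.

End Zonotope.

(** * Reduction to generators on which the cost is positive *)

Section NormalForm.
Variables (R : realType) (d : nat).
Local Notation V := 'rV[R]_d.

Lemma minkowski_sum_segments n (a b : 'I_n -> V) :
  minkowski_sum (fun i => segment (a i) (b i)) =
  zonotope (fun i => b i - a i) (\sum_i a i).
Proof.
have ptE (t : 'I_n -> R) : zpoint (fun i => b i - a i) (\sum_i a i) t =
    \sum_i ((1 - t i) *: a i + t i *: b i).
  rewrite /zpoint -big_split; apply: eq_bigr => i _ /=.
  by rewrite scalerBr scalerBl scale1r addrA addrAC.
apply/seteqP; split=> [x [f fab ->]|x [t t01 ->]].
  have /choice[t tP] : forall i, exists t : R, 0 <= t <= 1 /\ f i = (1 - t) *: a i + t *: b i.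
    by move=> i; have [t t01 ft] := fab i; exists t.
  exists t => [i|]; first by have [] := tP i.
  by rewrite ptE; apply: eq_bigr => i _; have [] := tP i.
exists (fun i => (1 - t i) *: a i + t i *: b i); last by rewrite ptE.
by move=> i; exists (t i).
Qed.

Variable I : finType.
Implicit Types (z : I -> V) (o c : V).

(** Reversing a segment replaces its parameter [t] by [1 - t] and moves the base point to the other
    end. *)
Lemma zonotope_flip z o (f : pred I) :
  zonotope z o =
  zonotope (fun i => if f i then - z i else z i) (o + \sum_(i | f i) z i).
Proof.
pose h (t : I -> R) i := if f i then 1 - t i else t i.
have ptE t : zpoint (fun i => if f i then - z i else z i) (o + \sum_(i | f i) z i) (h t) =
    zpoint z o t.
  rewrite /zpoint -addrA; congr (_ + _); rewrite big_mkcond -big_split.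
  apply: eq_bigr => i _; rewrite /h /=; case: (f i); last by rewrite add0r.
  by rewrite scalerN scalerBl scale1r opprB addrCA subrr addr0.
have h01 t : (forall i, 0 <= t i <= 1) -> forall i, 0 <= h t i <= 1.
  move=> t01 i; have /andP[t0 t1] := t01 i; rewrite /h; case: (f i); last exact: t01.
  by rewrite subr_ge0 t1 lerBlDr lerDl.
have hK t : h (h t) = t.
  by apply/funext => i; rewrite /h; case: (f i); rewrite ?subKr.
apply/seteqP; split=> x [t t01 ->]; exists (h t); rewrite ?ptE //; try exact: h01.
by rewrite -[in LHS](hK t) ptE.
Qed.

Lemma zonotope_drop0 z o :
  zonotope z o = zonotope (fun j : {i in [pred i | z i != 0]} => z (val j)) o.
Proof.
have ptE (t : I -> R) : zpoint z o t =
    zpoint (fun j : {i in [pred i | z i != 0]} => z (val j)) o (fun j => t (val j)).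
  rewrite /zpoint; congr (_ + _); rewrite (bigID (fun i => z i != 0)) /= [X in _ + X]big1.
    rewrite addr0; exact: (big_sub [pred i | z i != 0]).
  by move=> i /negPn/eqP ->; rewrite scaler0.
apply/seteqP; split=> x [t t01 ->]; first by exists (fun j => t (val j)).
pose t' i := if insub i is Some j then t j else 0.
exists t' => [i|].
  by rewrite /t'; case: insubP => [j _ _|_]; rewrite ?lexx ?ler01.
by rewrite ptE; congr (zpoint _ _ _); apply/funext => j; rewrite /t' valK.
Qed.

(* If [c] were orthogonal to [z i], the two vertices maximising [c] perturbed
   in opposite directions would have the same [c]-value. *)
Lemma generic_dot_neq0 z o c : (forall i, z i != 0) -> generic (zonotope z o) c ->
  forall i, dot c (z i) != 0.
Proof.
move=> z0 gen i; apply/negP => /eqP ci.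
have [h hz] := exists_regular z0.
have [M HM] := lex_perturbation z c h.
have [N HN] := lex_perturbation z c (- h).
have reg (l : R) e : (forall j, dot e (z j) != 0) ->
    (forall j, (0 < dot c (z j) -> 0 < dot (l *: c + e) (z j)) /\
    (dot c (z j) < 0 -> dot (l *: c + e) (z j) < 0)) -> regular z (l *: c + e).
  move=> ez He j; have [cj|cj|cj] := ltgtP (dot c (z j)) 0.
  - by rewrite lt_eqF // (He j).2.
  - by rewrite gt_eqF // (He j).1.
  - by rewrite dotDl dotZl cj mulr0 add0r.
have regM := reg M h hz HM.
have regN : regular z (N *: c - h) by apply: reg HN => j; rewrite dotNl oppr_eq0.
(* The two vertices can differ only in generators orthogonal to [c]. *)
have cE : dot c (top_vertex z o (M *: c + h)) = dot c (top_vertex z o (N *: c - h)).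
  rewrite !dotDr !dot_sumr; congr (_ + _); rewrite big_mkcond [RHS]big_mkcond.
  apply: eq_bigr => j _; have [cj|cj|cj] := ltgtP (dot c (z j)) 0.
  - by rewrite !ltNge !ltW //= ?(HM j).2 ?(HN j).2.
  - by rewrite (HM j).1 ?(HN j).1.
  - by rewrite cj !if_same.
have := gen _ _ (regular_vertex o regM) (regular_vertex o regN) cE.
move=> /(congr1 (fun v => i \in inv z o v)).
rewrite !inv_top_vertex // !dotDl !dotZl ci !mulr0 !add0r dotNl oppr_gt0.
by case: ltgtP (hz i).
Qed.

End NormalForm.

Lemma zonotope_normal_form (R : realType) d (P : set 'rV[R]_d) c :
  is_zonotope P -> generic P c ->
  exists (I : finType) (z : I -> 'rV[R]_d) o,
    (forall i, 0 < dot c (z i)) /\ P = zonotope z o.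
Proof.
move=> [n [a [b ->]]]; rewrite minkowski_sum_segments zonotope_drop0.
set z := (fun j : {i in _} => _); set o := \sum_i a i => gen.
have z0 j : z j != 0 by exact: (valP j).
have cz := generic_dot_neq0 z0 gen.
exists _, (fun i => if dot c (z i) < 0 then - z i else z i), 
  (o + \sum_(i | dot c (z i) < 0) z i); split; last exact: zonotope_flip.
move=> i; case: ifPn => [ci|]; first by rewrite dotNr oppr_gt0.
by rewrite -leNgt lt_def cz.
Qed.

(** * Open intervals *)

Lemma finset_enumeration (I : finType) (C : {set I}) :
  exists k (f : 'I_k -> I), injective f /\ forall i, i \in C <-> exists l, f l = i.
Proof.
exists #|C|, (fun l => enum_val l); split; first exact: enum_val_inj.
move=> i; split=> [iC|[l <-]]; last exact: enum_valP.
by exists (enum_rank_in iC i); rewrite enum_rankK_in.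
Qed.

Section Interval.
Variables (R : realType) (d : nat) (I : finType) (z : I -> 'rV[R]_d) (o c : 'rV[R]_d).
Hypothesis c_gt0 : forall i, 0 < dot c (z i).
Local Notation P := (zonotope z o).
Hypothesis simpleP : is_simple P.
Local Notation le := (G_le P c).
Local Notation inv := (inv z o).
Implicit Types x y u v w : 'rV[R]_d.

Let z_neq0 i : z i != 0.
Proof. by apply: contraTneq (c_gt0 i) => ->; rewrite dot0r ltxx. Qed.

Let leE x y : le x y <-> [/\ is_vertex P x, is_vertex P y & inv x \subset inv y].
Proof. exact: G_leE. Qed.

Lemma G_le_trans x y w : le x y -> le y w -> le x w.
Proof.
move=> /leE[xV _ xy] /leE[_ wV yw]; apply/leE; split=> //.
exact: fintype.subset_trans yw.
Qed.

Lemma G_le_anti x y : le x y -> le y x -> x = y.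
Proof.
move=> /leE[xV yV xy] /leE[_ _ yx]; apply: (inv_inj z_neq0 xV yV).
by apply/eqP; rewrite finset.eqEsubset xy.
Qed.

(** Vertices are subset sums of the generators, so the interval is listed by filtering these;
    distinct subsets may give the same point, hence [undup]. *)
Definition interval_seq u v :=
  [seq x <- undup [seq o + \sum_(i in T) z i | T : {set I} <- enum {set I}] |
    `[< open_interval le u v x >]].

Lemma interval_seqE u v : open_interval le u v = [set x | x \in interval_seq u v].
Proof.
apply/seteqP; split=> x /=; rewrite mem_filter; last by case/andP => /asboolP.
move=> ux; apply/andP; split; first exact/asboolP.
rewrite mem_undup; apply/mapP; exists (inv x); first by rewrite mem_enum.
by apply: vertex_inv => //; case: ux => /leE[].
Qed.

Lemma interval_ball_or_sphere u v : le u v ->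
  homotopy_ball_or_sphere R (realization R (order_complex le (open_interval le u v))).
Proof.
move=> uv; have [uV vV uvI] := (leE u v).1 uv.
rewrite interval_seqE; set r := interval_seq u v.
have rP x : x \in r <-> [/\ le u x, x <> u, le x v & x <> v].
  by rewrite (_ : (x \in r) = [set x | x \in r] x :> Prop) // -interval_seqE.
have r_uniq : uniq r by rewrite filter_uniq // undup_uniq.
(* For [u = v] the interval is empty and the model is the empty sphere: a one-element index set has
   no proper nonempty subset. *)
have [uEv|uNv] := pselect (v = u).
  have r0 x : x \in r -> False.
    by move=> /rP[ux xu xv _]; apply: xu; apply: G_le_anti => //; rewrite -uEv.
  have none (S : {set 'I_1}) : proper_nonempty_set S -> False.
    case/andP => /finset.set0Pn[i iS] /eqP; apply; apply/setP => j.
    by rewrite inE (ord1 j) -(ord1 i) iS.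
  apply: (@order_complex_sphere R _ le r r_uniq G_le_trans G_le_anti 0
    (fun=> finset.set0) (fun=> u)) => //.
  - by move=> x /r0.
  - by move=> S /none.
  - by move=> S S' _ _; apply/leE.
  - by move=> x /r0.
  - by move=> S /none.
have [B [Bu Bup Btop]] := upward_edges z_neq0 c_gt0 simpleP uV.
have [k [f [f_inj fC]]] := finset_enumeration (B :&: inv v)%SET.
have fB l : f l \in B /\ f l \in inv v.
  by have := (fC (f l)).2 (ex_intro _ l erefl); rewrite finset.in_setI => /andP[].
have /choice[J JP] : forall S : {set 'I_k}, exists y,
    [/\ is_vertex P y, inv u \subset inv y,
    forall l, (f l \in inv y) = (l \in S) &
    forall x, is_vertex P x -> inv u \subset inv x ->
      (forall l, l \in S -> f l \in inv x) -> inv y \subset inv x].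
  move=> S; have [|y [yV uy yB ymin _]] := Btop (f @: S)%SET.
    by apply/fintype.subsetP => i /imsetP[l _ ->]; have [] := fB l.
  exists y; split=> // [l|x xV ux Sx].
    by rewrite yB ?(fB l).1 // finset.mem_imset.
  apply: ymin => //; apply/fintype.subsetP => i /imsetP[l lS ->]; exact: Sx.
pose A x : {set 'I_k} := finset (fun l => f l \in inv x).
have memA x l : (l \in A x) = (f l \in inv x) by rewrite finset.in_set.
have rV x : x \in r -> is_vertex P x /\ inv u \subset inv x.
  by move=> /rP[/leE[]].
have A_mono x y : x \in r -> y \in r -> le x y -> A x \subset A y.
  move=> _ _ /leE[_ _ xy]; apply/fintype.subsetP => l; rewrite !memA.
  exact: (fintype.subsetP xy).
have up x : le u x -> x <> u -> le x v -> exists l, f l \in inv x.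
  move=> /leE[_ xV ux] xu /leE[_ _ xv]; have [i iB ix] := Bup x xV ux xu.
  have /fC[l li] : i \in (B :&: inv v)%SET.
    by rewrite finset.in_setI iB (fintype.subsetP xv).
  by exists l; rewrite li.
have A_neq0 x : x \in r -> A x != finset.set0.
  move=> /rP[ux xu xv _]; have [l lx] := up x ux xu xv.
  by apply/finset.set0Pn; exists l; rewrite memA.
have AJ S : A (J S) = S by apply/setP => l; rewrite memA; have [] := JP S.
have J_vertex S : is_vertex P (J S) by have [] := JP S.
have uJ S : le u (J S) by apply/leE; split=> //; have [] := JP S.
have Jv S : le (J S) v.
  by apply/leE; split=> //; have [_ _ _] := JP S; apply=> // l _; have [] := fB l.
have J_neq_u S : S != finset.set0 -> J S <> u.
  move=> /finset.set0Pn[l lS] Ju; have [_ _ Jf _] := JP S.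
  by have := Jf l; rewrite lS Ju (negbTE (Bu _ (fB l).1)).
have J_mono (S S' : {set 'I_k}) : S != finset.set0 -> S \subset S' -> le (J S) (J S').
  move=> _ SS'; apply/leE; split=> //; have [_ _ _] := JP S; apply=> //.
    by have [] := JP S'.
  by move=> l lS; have [_ _ -> _] := JP S'; exact: (fintype.subsetP SS').
have JA x : x \in r -> le (J (A x)) x.
  move=> /rV[xV ux]; apply/leE; split=> //; have [_ _ _] := JP (A x); apply=> // l.
  by rewrite memA.
(* Applied to [v] itself, this shows that the index set is not empty. *)
have [l0 _] := up v uv uNv ((leE v v).2 (And3 vV vV (fintype.subxx _))).
have [Jtop|Jtop] := eqVneq (J [set: 'I_k]%SET) v; last first.
  have J_r (S : {set 'I_k}) : S != finset.set0 -> J S \in r.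
    move=> S0; apply/rP; split=> //; first exact: J_neq_u.
    move=> JSv; case/eqP: Jtop; apply: G_le_anti; first exact: Jv.
    by rewrite -{1}JSv; apply: J_mono => //; exact: finset.subsetT.
  exact: (@order_complex_ball R _ le r r_uniq G_le_trans G_le_anti k l0 A J
    A_mono A_neq0 J_r J_mono JA).
case: k f f_inj fC fB J JP A memA A_mono up A_neq0 AJ J_vertex uJ Jv J_neq_u J_mono JA l0 Jtop
  => [|n] f f_inj fC fB J JP A memA A_mono up A_neq0 AJ J_vertex uJ Jv J_neq_u J_mono JA l0 Jtop.
  by case: l0.
have A_proper x : x \in r -> proper_nonempty_set (A x).
  move=> xr; rewrite /proper_nonempty_set A_neq0 //=; apply/eqP => AT.
  have [_ _ xv xnv] := (rP x).1 xr; apply: xnv; apply: G_le_anti => //.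
  by rewrite -Jtop -AT; exact: JA.
have J_r (S : {set 'I_n.+1}) : proper_nonempty_set S -> J S \in r.
  move=> /andP[S0 ST]; apply/rP; split=> //; first exact: J_neq_u.
  (* [A] is a left inverse of [J], so only the full set is sent to [v]. *)
  by move=> JSv; case/eqP: ST; apply: (can_inj AJ); rewrite JSv Jtop.
have AJ_sub (S : {set 'I_n.+1}) : proper_nonempty_set S -> A (J S) \subset S.
  by move=> _; rewrite AJ.
exact: (@order_complex_sphere R _ le r r_uniq G_le_trans G_le_anti n A J
  A_mono A_proper J_r J_mono JA AJ_sub).
Qed.

End Interval.

Theorem theorem5p11 (R : realType) (d : nat) (P : set 'rV[R]_d) (c : 'rV[R]_d) :
  is_zonotope P -> is_simple P -> generic P c ->
  forall u v : 'rV[R]_d, G_le P c u v ->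
    homotopy_ball_or_sphere R
      (realization R (order_complex (G_le P c) (open_interval (G_le P c) u v))).
Proof.
move=> zonoP simpleP genP u v uv.
have [I [z [p [cz PE]]]] := zonotope_normal_form zonoP genP.
by rewrite PE in simpleP uv *; exact: interval_ball_or_sphere.
Qed.
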